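(* Let $\Gamma$ be a digraphon on an atomless probability space $(\Omega,\mu)$, and let $\Omega=X_0\sqcup\bigsqcup_{i\in I}X_i$ be its decomposition into strong components. (i) We have $\rho(\Gamma)=\sup_{i\in I}\rho(\Gamma\llbracket X_i\rrbracket)$, where the supremum of the empty set is defined to be $0$. If $I\neq\emptyset$, this supremum is in fact a maximum. (ii) We have $\rho(\Gamma)=0$ if and only if $I=\emptyset$.
   Context: All subsets of $\Omega$ are assumed measurable. A digraphon on $(\Omega,\mu)$ is a measurable function $\Gamma:\Omega^2\to[0,1]$. A set $X\subseteq\Omega$ of positive measure is strongly connected in $\Gamma$ if $\int_{A\times B}\Gamma>0$ for every partition $A\sqcup B=X$ with $\mu(A),\mu(B)>0$; it is a strong component if it is strongly connected and no $Y\subseteq\Omega$ with $\mu(X\cap Y)>0$ and $\mu(Y\setminus X)>0$ is strongly connected; it is fragmented if no subset $Y\subseteq X$ of positive measure is strongly connected. The decomposition of $\Gamma$ into strong components is the (essentially unique) partition $\Omega=X_0\sqcup\bigsqcup_{i\in I}X_i$ with $I$ finite or countable, $0\notin I$, $X_0$ empty (or null) or fragmented, and each $X_i$ ($i\in I$) a strong component. For $A\subseteq\Omega$, $\Gamma\llbracket A\rrbracket$ is the digraphon on $\Omega$ equal to $\Gamma(x,y)$ if $x,y\in A$ and $0$ otherwise. A digraphon $\Gamma$ induces the compact operator $T_\Gamma$ on complex $L^2(\Omega)$, $(T_\Gamma f)(x)=\int_\Omega f(y)\Gamma(y,x)\,d\mu(y)$. Its spectral radius $\rho(\Gamma)$ is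 the supremum of the moduli of eigenvalues of $T_\Gamma$ ($0$ if there are none). *)

(* Defs.v *)
From HB Require Import structures.
From mathcomp Require Import all_boot all_order all_algebra.
From mathcomp Require Import all_classical all_reals all_analysis.
From mathcomp Require Import complex.

Set Implicit Arguments.
Unset Strict Implicit.
Unset Printing Implicit Defensive.

Import Order.TTheory GRing.Theory Num.Theory.
Import numFieldNormedType.Exports.
Import ComplexField.Normc.

Local Open Scope classical_set_scope.
Local Open Scope ring_scope.

Section Digraphons.
Context (d : measure_display) (T : measurableType d) (R : realType).
Variable mu : probability T R.

Definition atomless : Prop :=
  forall A : set T, measurable A -> (0 < mu A)%E ->
    exists B : set T,
      [/\ measurable B, B `<=` A, (0 < mu B)%E & (mu B < mu A)%E].

(* Measurability is with respect to the product sigma-algebra on T * T. *)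
Definition digraphon (G : T * T -> R) : Prop :=
  measurable_fun setT G /\ forall z, 0 <= G z <= 1.

Definition induced_digraphon (G : T * T -> R) (A : set T) : T * T -> R :=
  patch (cst 0) (A `*` A) G.

Lemma digraphon_induced (G : T * T -> R) (A : set T) :
  digraphon G -> measurable A -> digraphon (induced_digraphon G A).
Proof.
move=> [mG G01] mA; split.
  rewrite /induced_digraphon (_ : patch _ _ _ = G \_ (A `*` A))//.
  apply/(measurable_restrictT _ _).1; first exact: measurableX.
  exact: measurable_funTS.
by move=> z; rewrite /induced_digraphon /patch; case: ifP => // _; rewrite lexx ler01.
Qed.

Definition strongly_connected (G : T * T -> R) (X : set T) : Prop :=
  [/\ measurable X, (0 < mu X)%E &
    forall A B : set T, measurable A -> measurable B ->
      A `|` B = X -> A `&` B = set0 -> (0 < mu A)%E -> (0 < mu B)%E ->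
      (0 < \int[mu \x mu]_(z in A `*` B) (G z)%:E)%E].

Definition strong_component (G : T * T -> R) (X : set T) : Prop :=
  strongly_connected G X /\
  forall Y : set T, measurable Y ->
    (0 < mu (X `&` Y))%E -> (0 < mu (Y `\` X))%E -> ~ strongly_connected G Y.

Definition fragmented (G : T * T -> R) (X : set T) : Prop :=
  forall Y : set T, measurable Y -> Y `<=` X -> (0 < mu Y)%E ->
    ~ strongly_connected G Y.

Definition strong_decomposition (G : T * T -> R) (J : Type) (I : set J)
    (X0 : set T) (X : J -> set T) : Prop :=
  [/\ [/\ countable I, measurable X0 & forall i, I i -> measurable (X i)],
      [/\ X0 `|` \bigcup_(i in I) X i = setT,
          forall i, I i -> X0 `&` X i = set0 & trivIset I X],
      mu X0 = 0%E \/ fragmented G X0 &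
      forall i, I i -> strong_component G (X i)].

(* Representatives of elements of complex L^2; elements of L^2 are compared
   almost everywhere. *)
Definition complexL2 (f : T -> R[i]) : Prop :=
  [/\ measurable_fun setT (fun x => complex.Re (f x)),
      measurable_fun setT (fun x => complex.Im (f x)) &
      finite_norm mu 2%:E (fun x => normc (f x))].

Definition cintegral (f : T -> R[i]) : R[i] :=
  Complex (Rintegral mu setT (fun x => complex.Re (f x)))
          (Rintegral mu setT (fun x => complex.Im (f x))).

Definition kernel_op (G : T * T -> R) (f : T -> R[i]) : T -> R[i] :=
  fun x => cintegral (fun y => f y * (G (y, x))%:C%C).

Definition kernel_eigenvalue (G : T * T -> R) (lam : R[i]) : Prop :=
  exists f : T -> R[i],
    [/\ complexL2 f, ~ {ae mu, forall x, f x = 0} &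
        {ae mu, forall x, kernel_op G f x = lam * f x}].

(* The real-valued sup is 0 on the empty set by [sup0]. The set is bounded:
   if 0 <= G <= 1 then T_G has operator norm at most 1. *)
Definition spectral_radius (G : T * T -> R) : R :=
  sup [set normc lam | lam in kernel_eigenvalue G].

End Digraphons.

(* Main.v *)
Require Import Defs.
From HB Require Import structures.
From mathcomp Require Import all_boot all_order all_algebra.
From mathcomp Require Import all_classical all_reals all_analysis.
From mathcomp Require Import measurable_realfun.
From mathcomp Require Import complex ring lra.

Set Implicit Arguments.
Unset Strict Implicit.
Unset Printing Implicit Defensive.

Import Order.TTheory GRing.Theory Num.Theory.
Import numFieldNormedType.Exports.
Import ComplexField.Normc.

Local Open Scope classical_set_scope.
Local Open Scope ring_scope.

(** Write [T_K] for the integral operator of a digraphon [K] and call [t > 0] a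
growth bound of [K] if some bounded measurable function [u >= 1] satisfies
[T_K u <= t u] pointwise. The whole argument runs through the fact that the
spectral radius of [K] is the infimum [r] of its growth bounds
([spectral_radius_le] and [growth_bound_gt]), a Collatz-Wielandt
characterisation in which no eigenvalue occurs.

That no eigenvalue exceeds a growth bound in modulus is a comparison of
[|f| / u] with its supremum, for an eigenfunction [f]. That a positive [r] is
itself an eigenvalue is a Krein-Rutman theorem. For [t] slightly above [r] a
long partial sum [w] of the Neumann series of [(t - T_K)^-1 1] has a large
integral, since otherwise [w] itself would witness a growth bound below [r].
Normalising [w] gives functions [h >= 0] with [h <= 2 / r] and integral [1] for
which [T_K h - r h] is uniformly small. Compactness is replaced by a convexity
argument: these functions form a convex set, so near-minimisers of the integral
of [h^2] are Cauchy in mean square by the parallelogram identity; as [T_K] maps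
convergence in mean to uniform convergence and [h] is close to [T_K h / r],
they converge uniformly, and the limit is an eigenfunction.

Growth bounds are easy to manipulate: by constructing suitable functions [u] one
sees that the spectral radius increases with the digraphon and, writing [rho A]
for the spectral radius of the digraphon induced on [A], that [rho A] is at most
the measure of [A], that [rho (B + C)] is at most the larger of [rho B] and
[rho C] if no edges lead from [B] to [C] ([rho_block]), and that [r <= rho A] passes to decreasing intersections ([rho_bigcap]). Hence, for
[r > 0], among the sets [A] with [r <= rho A] there is one of least measure, and
it is strongly connected because an empty cut would leave one of two smaller
sets with the same property ([strongly_connected_core]). Taking for [r] the
spectral radius of the whole digraphon, such a set meets some strong component
in positive measure, hence lies in it up to a null set, and this component
attains the supremum.

Finally a strongly connected set [X] has positive spectral radius. The
weight of closed walks of length [n + 2], that is the trace of [T^(n+2)], is at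
most any growth bound [t <= 1], by the inequality
[u y / u x + u x / u y >= 2] ([cycle_weight_le]). If all these weights vanished,
then, since by strong connectedness almost every point with an out-edge reaches
almost all of [X], almost no point would have both in- and out-edges. Either the
points without out-edges or the points without in-edges would then allow a cut of
[X] without edges, because the space is atomless ([cycle_weight_gt0]). *)

(** * Bounded measurable functions *)

Definition bmeas d (T : measurableType d) (R : realType) (f : T -> R) :=
  measurable_fun setT f /\ exists C, forall x, `|f x| <= C.

Section BoundedMeasurable.
Context d (T : measurableType d) (R : realType).
Implicit Types f g : T -> R.

Lemma bmeas_cst (c : R) : bmeas (fun _ : T => c).
Proof. by split; [exact: measurable_cst | exists `|c|]. Qed.

Lemma bmeasD f g : bmeas f -> bmeas g -> bmeas (fun x => f x + g x).
Proof.
move=> [mf [C fC]] [mg [D gD]]; split; first exact: measurable_funD.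
by exists (C + D) => x; rewrite (le_trans (ler_normD _ _))// lerD.
Qed.

Lemma bmeasM f g : bmeas f -> bmeas g -> bmeas (fun x => f x * g x).
Proof.
move=> [mf [C fC]] [mg [D gD]]; split; first exact: measurable_funM.
by exists (C * D) => x; rewrite normrM ler_pM.
Qed.

Lemma bmeasZ (c : R) f : bmeas f -> bmeas (fun x => c * f x).
Proof. by apply: bmeasM; exact: bmeas_cst. Qed.

Lemma bmeasB f g : bmeas f -> bmeas g -> bmeas (fun x => f x - g x).
Proof.
move=> bf bg; have := bmeasD bf (bmeasZ (-1) bg).
by congr bmeas; apply/funext => x /=; rewrite mulN1r.
Qed.

Lemma bmeas_norm f : bmeas f -> bmeas (fun x => `|f x|).
Proof.
move=> [mf [C fC]]; split; first exact: measurableT_comp.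
by exists C => x; rewrite normr_id.
Qed.

Lemma bmeas_indic (A : set T) : measurable A ->
  bmeas (\1_A : T -> R).
Proof.
move=> mA; split; first exact: measurable_indic.
by exists 1 => x; rewrite indicE ger0_norm ?ler0n// lern1 leq_b1.
Qed.

Lemma bmeas_inv f : bmeas f -> (forall x, 1 <= f x) -> bmeas (fun x => (f x)^-1).
Proof.
move=> [mf _] f1; split.
  rewrite (_ : (fun _ => _) = (@powR R ^~ (-1)) \o f).
    by apply: measurableT_comp => //; exact: measurable_powR.
  by apply/funext => x /=; rewrite powR_inv1// (le_trans _ (f1 x)).
exists 1 => x; rewrite ger0_norm ?invr_ge0 ?(le_trans _ (f1 x))//.
by rewrite invf_le1// (lt_le_trans _ (f1 x)).
Qed.

Lemma bmeas_comp d' (T' : measurableType d') (h : T' -> T) f :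
  measurable_fun setT h -> bmeas f -> bmeas (fun x => f (h x)).
Proof.
move=> mh [mf [C fC]]; split; first exact: (measurableT_comp mf mh).
by exists C => x; exact: fC.
Qed.

Lemma bmeas_ub f : bmeas f -> exists2 C, 0 < C & forall x, `|f x| <= C.
Proof.
move=> [_ [C fC]]; exists (`|C| + 1); first by rewrite ltr_wpDl.
by move=> x; rewrite (le_trans (fC x))// (le_trans (ler_norm C))// lerDl.
Qed.

Lemma bmeas_gt0_set f : bmeas f -> measurable [set x | 0 < f x].
Proof.
move=> [mf _].
have := @measurable_fun_ltr _ _ _ setT (fun=> 0) f (measurable_cst _) mf.
move=> /(_ measurableT [set true] I); rewrite setTI.
by congr measurable; apply/seteqP; split => x /=; case: (0 < f x).
Qed.

End BoundedMeasurable.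

Section Expectation.
Context d (T : measurableType d) (R : realType) (mu : probability T R).
Implicit Types f g : T -> R.

Lemma bmeas_integrable f : bmeas f -> mu.-integrable setT (EFin \o f).
Proof.
move=> [mf [C fC]]; apply: measurable_bounded_integrable => //.
  by apply: (@le_lt_trans _ _ 1%E); [exact: probability_le1|exact: ltry].
exists C; split; first exact: num_real.
by move=> y Cy x _; apply: (le_trans (fC x)); exact: ltW.
Qed.

Lemma fineK_integral f : bmeas f ->
  (\int[mu]_x f x)%:E = (\int[mu]_x (f x)%:E)%E.
Proof. by move=> bf; rewrite fineK//; apply: integrable_fin_num => //; exact: bmeas_integrable. Qed.

Lemma intD f g : bmeas f -> bmeas g ->
  \int[mu]_x (f x + g x) = \int[mu]_x f x + \int[mu]_x g x.
Proof. by move=> bf bg; rewrite RintegralD//; exact: bmeas_integrable. Qed.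

Lemma intB f g : bmeas f -> bmeas g ->
  \int[mu]_x (f x - g x) = \int[mu]_x f x - \int[mu]_x g x.
Proof. by move=> bf bg; rewrite RintegralB//; exact: bmeas_integrable. Qed.

Lemma intZ (c : R) f : bmeas f -> \int[mu]_x (c * f x) = c * \int[mu]_x f x.
Proof. by move=> bf; rewrite RintegralZl//; exact: bmeas_integrable. Qed.

Lemma int_cst (c : R) : \int[mu]_x c = c.
Proof.
rewrite Rintegral_cst//; transitivity (c * fine (1%E : \bar R)); last by rewrite mulr1.
by congr (c * fine _); exact: probability_setT.
Qed.

Lemma int_ge0 f : (forall x, 0 <= f x) -> 0 <= \int[mu]_x f x.
Proof. by move=> f0; apply: Rintegral_ge0. Qed.

Lemma int_ext f g : (forall x, f x = g x) -> \int[mu]_x f x = \int[mu]_x g x.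
Proof. by move=> fg; apply: eq_Rintegral => x _. Qed.

Lemma le_int f g : bmeas f -> bmeas g -> (forall x, f x <= g x) ->
  \int[mu]_x f x <= \int[mu]_x g x.
Proof. by move=> bf bg fg; apply: le_Rintegral => //; exact: bmeas_integrable. Qed.

Lemma le_norm_int f : bmeas f -> `|\int[mu]_x f x| <= \int[mu]_x `|f x|.
Proof. by move=> bf; apply: le_normr_Rintegral => //; exact: bmeas_integrable. Qed.

Lemma int_le_cst f (c : R) : bmeas f -> (forall x, f x <= c) ->
  \int[mu]_x f x <= c.
Proof.
move=> bf fc; rewrite -[leRHS](int_cst c).
by apply: le_int => //; exact: bmeas_cst.
Qed.

Lemma int_indic (A : set T) : measurable A -> \int[mu]_x (\1_A x) = fine (mu A).
Proof. by move=> mA; rewrite /Rintegral integral_indic// setIT. Qed.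

Lemma int_null_indic (N : set T) f : bmeas f -> measurable N -> mu N = 0%E ->
  \int[mu]_x (\1_N x * f x) = 0.
Proof.
move=> bf mN N0; have [C C0 fC] := bmeas_ub bf.
have bNf := bmeasM (bmeas_indic R mN) bf.
apply/eqP; rewrite -normr_le0 (le_trans (le_norm_int _))//.
rewrite (@le_trans _ _ (\int[mu]_x (C * \1_N x)))//.
  apply: le_int; [exact: bmeas_norm|exact/bmeasZ/bmeas_indic|].
  by move=> x; rewrite normrM ger0_norm ?indicE ?ler0n// mulrC ler_wpM2r.
by rewrite intZ ?int_indic ?N0 ?mulr0//; exact: bmeas_indic.
Qed.

Lemma int_null_support f (N : set T) : bmeas f -> measurable N -> mu N = 0%E ->
  (forall x, ~ N x -> f x = 0) -> \int[mu]_x f x = 0.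
Proof.
move=> bf mN N0 fN; rewrite -(int_null_indic bf mN N0).
apply: int_ext => x; rewrite indicE.
by have [_|/negP] := boolP (x \in N); rewrite ?mul1r// inE mul0r => /fN.
Qed.

Lemma le_int_null f g (N : set T) : bmeas f -> bmeas g ->
  measurable N -> mu N = 0%E -> (forall x, ~ N x -> f x <= g x) ->
  \int[mu]_x f x <= \int[mu]_x g x.
Proof.
move=> bf bg mN N0 fg.
have bN (h : T -> R) : bmeas h -> bmeas (fun x => \1_N x * h x).
  by apply: bmeasM; exact: bmeas_indic.
have -> : \int[mu]_x f x = \int[mu]_x (f x - \1_N x * f x).
  by rewrite intB ?int_null_indic ?subr0//; exact: bN.
have -> : \int[mu]_x g x = \int[mu]_x (g x - \1_N x * g x).
  by rewrite intB ?int_null_indic ?subr0//; exact: bN.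
apply: le_int; [by apply: bmeasB => //; exact: bN|by apply: bmeasB => //; exact: bN|].
move=> x; rewrite indicE.
have [_|/negP] := boolP (x \in N); rewrite ?mul1r ?subrr//.
by rewrite inE !mul0r !subr0 => /fg.
Qed.

Lemma null_of_int0 f : bmeas f -> (forall x, 0 <= f x) -> \int[mu]_x f x = 0 ->
  mu [set x | 0 < f x] = 0%E.
Proof.
move=> bf f0 intf0; have [mf _] := bf.
have : (\int[mu]_x `|(f x)%:E| = 0)%E.
  under eq_integral do rewrite gee0_abs ?lee_fin//.
  by rewrite -fineK_integral// intf0.
move=> /(ae_eq_integral_abs _ measurableT _).1.
move=> /(_ ltac:(exact/measurable_EFinP)) [N [mN N0 fN]].
apply: (subset_measure0 (B := N)) => //; first exact: bmeas_gt0_set.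
by move=> x /= fx; apply: fN => /= /(_ I) -[fx0]; rewrite fx0 ltxx in fx.
Qed.

End Expectation.

Section Sections.
Context d1 d2 (T1 : measurableType d1) (T2 : measurableType d2) (R : realType).

Lemma bmeas_sectionl (F : T1 * T2 -> R) x : bmeas F -> bmeas (fun y => F (x, y)).
Proof. by apply: bmeas_comp; exact: pair1_measurable. Qed.

Lemma bmeas_sectionr (F : T1 * T2 -> R) y : bmeas F -> bmeas (fun x => F (x, y)).
Proof. by apply: bmeas_comp; exact: pair2_measurable. Qed.

Lemma bmeas_prod_integrable (m1 : probability T1 R) (m2 : probability T2 R)
  (F : T1 * T2 -> R) : bmeas F -> (m1 \x m2)%E.-integrable setT (EFin \o F).
Proof.
move=> [mF [C FC]]; apply: measurable_bounded_integrable => //.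
  have E : (m1 \x m2)%E (setT `*` setT) = (m1 setT * m2 setT)%E.
    exact: product_measure1E.
  rewrite setXTT in E; apply: (@le_lt_trans _ _ (m1 setT * m2 setT)%E).
    by rewrite -E.
  apply: (@le_lt_trans _ _ (1 * 1)%E); last by rewrite mule1 ltry.
  by apply: lee_pmul => //; exact: probability_le1.
exists C; split; first exact: num_real.
by move=> y Cy x _; apply: (le_trans (FC x)); exact: ltW.
Qed.

(** Adding a bound of [F] reduces measurability to Tonelli's theorem. *)
Lemma bmeas_int (m : probability T2 R) (F : T1 * T2 -> R) : bmeas F ->
  bmeas (fun x => \int[m]_y F (x, y)).
Proof.
move=> bF; have [C C0 FC] := bmeas_ub bF; split; last first.
  exists C => x; have bFx := bmeas_sectionl x bF.
  by rewrite (le_trans (le_norm_int _ _))// int_le_cst//; exact: bmeas_norm.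
have bFC : bmeas (fun z => F z + C) by apply: bmeasD => //; exact: bmeas_cst.
have FC0 z : (0 <= (F z + C)%:E)%E.
  by rewrite lee_fin -lerBlDr sub0r; have /ler_normlP[] := FC z; rewrite lerNl.
have mFC : measurable_fun setT (fun z => (F z + C)%:E).
  by apply/measurable_EFinP; case: bFC.
have -> : (fun x => \int[m]_y F (x, y)) =
    (fun x => \int[m]_y (F (x, y) + C) - C).
  apply/funext => x; rewrite intD ?int_cst ?addrK//; first exact: bmeas_sectionl.
  exact: bmeas_cst.
apply: measurable_funB => //.
have := measurable_fun_fubini_tonelli_F (m2 := m) _ mFC FC0.
by move=> mI; apply: (measurableT_comp _ mI); exact: fine_measurable.
Qed.

End Sections.

Section Product.
Context d1 d2 (T1 : measurableType d1) (T2 : measurableType d2) (R : realType).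
Variables (m1 : probability T1 R) (m2 : probability T2 R).

Lemma int_prod (F : T1 * T2 -> R) : bmeas F ->
  (\int[m1 \x m2]_z (F z)%:E)%E = (\int[m1]_x \int[m2]_y F (x, y))%:E.
Proof.
move=> bF; have /integral12_prod_meas1 <- := bmeas_prod_integrable m1 m2 bF.
rewrite fineK_integral; last exact: bmeas_int.
apply: eq_integral => x _; rewrite fineK_integral//; exact: bmeas_sectionl.
Qed.

Lemma int_swap (F : T1 * T2 -> R) : bmeas F ->
  \int[m1]_x \int[m2]_y F (x, y) = \int[m2]_y \int[m1]_x F (x, y).
Proof.
move=> bF; have bG : bmeas (fun p : T2 * T1 => F (p.2, p.1)).
  by apply: bmeas_comp bF; exact: measurable_swap.
have bG' : bmeas (fun y => \int[m1]_x F (x, y)).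
  exact: (bmeas_int m1 bG).
apply: EFin_inj; rewrite -int_prod// fineK_integral//.
have /integral21_prod_meas1 <- := bmeas_prod_integrable m1 m2 bF.
by apply: eq_integral => y _; rewrite fineK_integral//; exact: bmeas_sectionr.
Qed.

End Product.

(** * The kernel operator and its growth bounds *)

Section KernelOperator.
Context d (T : measurableType d) (R : realType) (mu : probability T R).
Implicit Types (K : T * T -> R) (u v : T -> R).

(** The action of [kernel_op] on real functions. *)
Definition kop K u x := \int[mu]_y (u y * K (y, x)).

Lemma bmeas_digraphon K : digraphon K -> bmeas K.
Proof.
by move=> [mK K01]; split => //; exists 1 => z; have /andP[? ?] := K01 z; rewrite ger0_norm.
Qed.

Lemma digraphon_ge0 K z : digraphon K -> 0 <= K z.
Proof. by move=> [_ /(_ z)/andP[]]. Qed.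

Lemma digraphon_le1 K z : digraphon K -> K z <= 1.
Proof. by move=> [_ /(_ z)/andP[]]. Qed.

Lemma bmeas_kop_integrand K u x : digraphon K -> bmeas u ->
  bmeas (fun y => u y * K (y, x)).
Proof.
by move=> dK bu; apply: bmeasM => //; exact: (bmeas_sectionr _ (bmeas_digraphon dK)).
Qed.

Lemma bmeas_kop K u : digraphon K -> bmeas u -> bmeas (kop K u).
Proof.
move=> dK bu; apply: (@bmeas_int _ _ _ _ _ mu (fun p => u p.2 * K (p.2, p.1))).
apply: bmeasM; first exact: (bmeas_comp measurable_snd bu).
by apply: bmeas_comp (bmeas_digraphon dK); exact: measurable_swap.
Qed.

Lemma kopD K u v x : digraphon K -> bmeas u -> bmeas v ->
  kop K (fun y => u y + v y) x = kop K u x + kop K v x.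
Proof.
move=> dK bu bv; rewrite /kop -intD; [|exact: bmeas_kop_integrand..].
by apply: int_ext => y; rewrite mulrDl.
Qed.

Lemma kopZ K u (c : R) x : digraphon K -> bmeas u ->
  kop K (fun y => c * u y) x = c * kop K u x.
Proof.
move=> dK bu; rewrite /kop -intZ; last exact: bmeas_kop_integrand.
by apply: int_ext => y; rewrite mulrA.
Qed.

Lemma kopB K u v x : digraphon K -> bmeas u -> bmeas v ->
  kop K (fun y => u y - v y) x = kop K u x - kop K v x.
Proof.
move=> dK bu bv; rewrite /kop -intB; [|exact: bmeas_kop_integrand..].
by apply: int_ext => y; rewrite mulrBl.
Qed.

Lemma kop_ge0 K u x : digraphon K -> (forall y, 0 <= u y) -> 0 <= kop K u x.
Proof. by move=> dK u0; apply: int_ge0 => y; rewrite mulr_ge0// digraphon_ge0. Qed.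

Lemma le_kop_null K u v N x : digraphon K -> bmeas u -> bmeas v ->
  measurable N -> mu N = 0%E -> (forall y, ~ N y -> u y <= v y) ->
  kop K u x <= kop K v x.
Proof.
move=> dK bu bv mN N0 uv; apply: (le_int_null _ _ mN N0); [exact: bmeas_kop_integrand..|].
by move=> y /uv uvy; rewrite ler_wpM2r// digraphon_ge0.
Qed.

Lemma le_kop K u v x : digraphon K -> bmeas u -> bmeas v ->
  (forall y, u y <= v y) -> kop K u x <= kop K v x.
Proof.
move=> dK bu bv uv; apply: (@le_kop_null _ _ _ set0) => //; exact: measure0.
Qed.

Lemma le_kop_kernel K K' u x : digraphon K -> digraphon K' -> bmeas u ->
  (forall y, 0 <= u y) -> (forall z, K z <= K' z) -> kop K u x <= kop K' u x.
Proof.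
move=> dK dK' bu u0 KK'; apply: le_int; [exact: bmeas_kop_integrand..|].
by move=> y; rewrite ler_wpM2l.
Qed.

(** The operator maps mean convergence to uniform convergence; this is the only
smoothing property of integral operators that is used. *)
Lemma norm_kop_le K u x : digraphon K -> bmeas u ->
  `|kop K u x| <= \int[mu]_y `|u y|.
Proof.
move=> dK bu; have bK := bmeas_kop_integrand x dK bu.
rewrite (le_trans (le_norm_int _ _))// le_int//; [exact: bmeas_norm..|].
move=> y; rewrite normrM ler_piMr// ger0_norm; [exact: digraphon_le1|exact: digraphon_ge0].
Qed.

Lemma kop_le_int K u x : digraphon K -> bmeas u -> (forall y, 0 <= u y) ->
  kop K u x <= \int[mu]_y u y.
Proof.
move=> dK bu u0; apply: (le_trans (ler_norm _)); apply: (le_trans (norm_kop_le _ dK bu)).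
by apply: le_int => //; [exact: bmeas_norm|move=> y; rewrite ger0_norm].
Qed.

(** The bound [1 <= u] makes the powers of the operator at most a constant times
[t ^+ n], uniformly. *)
Definition growth_bound K (t : R) := 0 < t /\
  exists u, [/\ bmeas u, forall x, 1 <= u x & forall x, kop K u x <= t * u x].

Lemma growth_bound_le K (s t : R) : s <= t -> growth_bound K s -> growth_bound K t.
Proof.
move=> st [s0 [u [bu u1 Ku]]]; split; first exact: lt_le_trans st.
exists u; split => // x; rewrite (le_trans (Ku x))// ler_wpM2r// (le_trans _ (u1 x))//.
Qed.

Lemma growth_bound_kernel K K' (t : R) : digraphon K -> digraphon K' ->
  (forall z, K z <= K' z) -> growth_bound K' t -> growth_bound K t.
Proof.
move=> dK dK' KK' [t0 [u [bu u1 Ku]]]; split => //; exists u; split => // x.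
rewrite (le_trans _ (Ku x))// le_kop_kernel// => y.
by rewrite (le_trans _ (u1 y)).
Qed.

Lemma growth_bound1 K : digraphon K -> growth_bound K 1.
Proof.
move=> dK; split => //; exists (fun=> 1); split => //; first exact: bmeas_cst.
move=> x; rewrite mul1r -[leRHS](int_cst mu); apply: kop_le_int => //.
exact: bmeas_cst.
Qed.

Lemma expr_lt_ex (q e : R) : 0 <= q -> q < 1 -> 0 < e -> exists n, q ^+ n < e.
Proof.
move=> q0 q1 e0; have nq : `|q| < 1 by rewrite ger0_norm.
have /cvgrPdist_lt/(_ e e0)[n _ /(_ n (leqnn n))/=] := cvg_expr nq.
by rewrite sub0r normrN ger0_norm ?exprn_ge0// => ?; exists n.
Qed.

(** A function [w] with [t w - T w = 1] would be the Neumann series of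
[(t - T)^-1 1]. A partial sum is enough: its defect is a term of the series,
which is at most [(s / t) ^+ n] times a constant because [s] is a growth bound. *)
Lemma resolvent_approx K (s t : R) : digraphon K -> growth_bound K s -> s < t ->
  exists w, [/\ bmeas w, forall x, t^-1 <= w x &
    forall x, 1 / 2 <= t * w x - kop K w x <= 1].
Proof.
move=> dK [s0 [u [bu u1 Ku]]] st; have t0 := lt_trans s0 st.
(* the fixed-point iteration for [w = t^-1 (1 + T w)]: these are the partial sums *)
pose fix w n := if n is m.+1 then (fun x => t^-1 * (1 + kop K (w m) x))
  else (fun _ : T => 0).
have bw n : bmeas (w n).
  elim: n => [|n IH] /=; first exact: bmeas_cst.
  by apply/bmeasZ/bmeasD; [exact: bmeas_cst|exact: bmeas_kop].
have w0 n x : 0 <= w n x.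
  elim: n x => [//|n IH] x /=.
  by rewrite mulr_ge0 ?invr_ge0 ?addr_ge0 ?(ltW t0)//; exact: kop_ge0.
have step n x : t * w n.+1 x = 1 + kop K (w n) x.
  by rewrite /= mulrA divff ?mul1r// gt_eqF.
pose D n x := w n.+1 x - w n x.
have bD n : bmeas (D n) by exact: bmeasB.
have DS n x : D n.+1 x = t^-1 * kop K (D n) x.
  have E m : w m.+1 x = t^-1 * (1 + kop K (w m) x) by [].
  by rewrite /D [X in X - _]E [X in _ - X]E kopB// -mulrBr opprD addrACA subrr add0r.
have bDu n x : 0 <= D n x <= (s / t) ^+ n * (u x / t).
  elim: n x => [|n IH] x.
    rewrite /D /= subr0 expr0 mul1r.
    have -> : kop K (fun=> 0) x = 0.
      by rewrite /kop -[RHS](int_cst mu); apply: int_ext => y; rewrite mul0r.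
    by rewrite addr0 mulr1 invr_ge0 ltW//= ler_peMl// invr_ge0 ltW.
  rewrite DS; apply/andP; split.
    by rewrite mulr_ge0 ?invr_ge0 ?(ltW t0)// kop_ge0// => y; have /andP[] := IH y.
  rewrite -ler_pdivlMl ?invr_gt0// invrK.
  have bv : bmeas (fun y => (s / t) ^+ n / t * u y) by exact: bmeasZ.
  have le1 : kop K (D n) x <= kop K (fun y => (s / t) ^+ n / t * u y) x.
    by apply: le_kop => // y; have /andP[_] := IH y; rewrite mulrA mulrAC.
  rewrite (le_trans le1)// kopZ// exprSr.
  have -> : t * ((s / t) ^+ n * (s / t) * (u x / t)) = (s / t) ^+ n / t * (s * u x).
    by field; rewrite gt_eqF.
  by rewrite ler_wpM2l// divr_ge0 ?exprn_ge0 ?divr_ge0// ltW.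
have [C C0 uC] := bmeas_ub bu.
have [n qn] : exists n, (s / t) ^+ n < 1 / 2 / C.
  apply: expr_lt_ex; first by rewrite divr_ge0// ltW.
    by rewrite ltr_pdivrMr// mul1r.
  by rewrite !divr_gt0.
exists (w n.+1); split => // [x|x].
  by rewrite /= ler_peMr ?invr_ge0 ?(ltW t0)// lerDl kop_ge0.
have -> : t * w n.+1 x - kop K (w n.+1) x = 1 - t * D n.+1 x.
  rewrite /D mulrBr (step n.+1); move: (kop K _ x) (t * _) => a b.
  by ring.
have /andP[D0 Du] := bDu n.+1 x.
have uC' : u x <= C by rewrite (le_trans (ler_norm _)).
have : t * D n.+1 x <= 1 / 2.
  rewrite (le_trans (ler_wpM2l (ltW t0) Du))//.
  have -> : t * ((s / t) ^+ n.+1 * (u x / t)) = (s / t) ^+ n.+1 * u x.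
    by field; rewrite gt_eqF.
  have q1 : (s / t) ^+ n.+1 <= 1 / 2 / C.
    rewrite exprSr (le_trans _ (ltW qn))// ler_piMr ?exprn_ge0 ?divr_ge0 ?(ltW s0) ?(ltW t0)//.
    by rewrite ler_pdivrMr// mul1r ltW.
  rewrite (@le_trans _ _ (1 / 2 / C * C))//; last by rewrite divfK// gt_eqF.
  by rewrite ler_pM ?exprn_ge0 ?divr_ge0 ?(ltW s0) ?(ltW t0)// (le_trans _ (u1 x)).
have : 0 <= t * D n.+1 x by rewrite mulr_ge0// ltW.
by move=> ? ?; apply/andP; split; lra.
Qed.

End KernelOperator.

(** * A nonnegative eigenfunction at the least growth bound *)

Section PositiveEigenfunction.
Context d (T : measurableType d) (R : realType) (mu : probability T R).
Variables (K : T * T -> R) (dK : digraphon K).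
Implicit Types (u v : T -> R).
Local Notation kop := (kop mu).

Definition near_eigen (r e : R) (h : T -> R) :=
  [/\ bmeas h, forall x, 0 <= h x <= 2 / r, \int[mu]_x h x = 1 &
    forall x, `|kop K h x - r * h x| <= e].

(** With [w] as in [resolvent_approx] for [t] close to [r], a small integral of [w]
would bound [w] by some [M'], and [T w <= t w - 1 / 2 <= (t - 1 / (2 M')) w]
would contradict the minimality of [r]. So the integral of [w] is large, and the
normalised [w] is a near eigenfunction. *)
Lemma near_eigen_ex (r : R) : 0 < r ->
  (forall t, r < t -> growth_bound mu K t) ->
  (forall t, growth_bound mu K t -> r <= t) ->
  forall e, 0 < e -> exists h, near_eigen r e h.
Proof.
move=> r0 above below e e0.
pose M := 1 + 2 / e; pose M' := (1 + M) / r.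
have e20 : 0 < 2 / e by rewrite divr_gt0.
have M1 : 1 < M by rewrite /M ltrDl.
have M0 : 0 < M by lra.
have M'0 : 0 < M' by rewrite divr_gt0//; lra.
have iM'0 : 0 < M'^-1 by rewrite invr_gt0.
pose del := Num.min (M'^-1 / 4) (e * r / 4).
have del0 : 0 < del by rewrite lt_min !divr_gt0// mulr_gt0.
have delM : del <= M'^-1 / 4 by rewrite ge_min lexx.
have dele : del <= e * r / 4 by rewrite ge_min lexx orbT.
pose t := r + del; have rt : r < t by rewrite ltrDl.
have t0 : 0 < t by exact: lt_trans rt.
have gs : growth_bound mu K (r + del / 2) by apply: above; lra.
have st : r + del / 2 < t by rewrite /t; lra.
have [w [bw wt wK]] := resolvent_approx dK gs st.
have it0 : 0 < t^-1 by rewrite invr_gt0.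
have w0 x : 0 < w x by exact: lt_le_trans (wt x).
have w0' x : 0 <= w x by exact: ltW.
have Kw0 x : 0 <= kop K w x by exact: kop_ge0.
pose E := \int[mu]_x w x.
have KwE x : kop K w x <= E by exact: kop_le_int.
have wE x : t * w x <= 1 + E.
  by have /andP[_] := wK x; have := KwE x; lra.
have [EM|ME] := leP E M.
  (* the maximum with [r / 2] only keeps the bound positive *)
  have wM' x : w x <= M'.
    rewrite /M' ler_pdivlMr// mulrC (@le_trans _ _ (t * w x))//; last by have := wE x; lra.
    by rewrite ler_wpM2r// ltW.
  have : growth_bound mu K (Num.max (t - M'^-1 / 2) (r / 2)).
    split; first by rewrite lt_max divr_gt0// orbT.
    exists (fun x => t * w x); split; first exact: bmeasZ.
      by move=> x; rewrite mulrC -ler_pdivrMr// mul1r.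
    move=> x; rewrite kopZ// mulrCA ler_wpM2l ?(ltW t0)//.
    rewrite (@le_trans _ _ ((t - M'^-1 / 2) * w x))//; last first.
      by rewrite ler_wpM2r// le_max lexx.
    have : M'^-1 * w x <= 1 by rewrite mulrC ler_pdivrMr// mul1r.
    have /andP[+ _] := wK x; move: (M'^-1) => iM'; lra.
  move=> /below; rewrite le_max => /orP[|]; last by lra.
  by rewrite /t; lra.
have E0 : 0 < E by lra.
have E1 : E^-1 <= 1 by rewrite invf_le1//; lra.
have iE0 : 0 < E^-1 by rewrite invr_gt0.
have iEe : E^-1 <= e / 2.
  rewrite -[leRHS]invrK lef_pV2 ?posrE ?invr_gt0//; last by rewrite divr_gt0.
  by rewrite invf_div; move: ME; rewrite /M; lra.
have hr x : E^-1 * w x <= 2 / r.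
  rewrite ler_pdivlMr// (@le_trans _ _ (E^-1 * (t * w x)))//.
    by rewrite -mulrA ler_wpM2l ?(ltW iE0)// mulrC ler_wpM2r// ltW.
  rewrite (le_trans (ler_wpM2l (ltW iE0) (wE x)))// mulrDr mulr1 mulVf ?gt_eqF//.
  by lra.
exists (fun x => E^-1 * w x); split.
- exact: bmeasZ.
- by move=> x; rewrite mulr_ge0 ?(ltW iE0)//=.
- by rewrite intZ// mulVf// gt_eqF.
move=> x; rewrite kopZ//.
have -> : E^-1 * kop K w x - r * (E^-1 * w x) =
    del * (E^-1 * w x) - E^-1 * (t * w x - kop K w x).
  by rewrite /t; ring.
have h0 : 0 <= E^-1 * w x by rewrite mulr_ge0// ltW.
have dh : del * (E^-1 * w x) <= e / 2.
  rewrite (le_trans (ler_pM (ltW del0) h0 dele (hr x)))//.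
  by rewrite le_eqVlt; apply/orP; left; apply/eqP; field; rewrite gt_eqF.
have dh0 : 0 <= del * (E^-1 * w x) by rewrite mulr_ge0// ltW.
have /andP[wK1 wK2] := wK x.
have r1 : E^-1 * (t * w x - kop K w x) <= e / 2.
  by rewrite (le_trans _ iEe)// ler_piMr// ltW.
have r0' : 0 <= E^-1 * (t * w x - kop K w x) by rewrite mulr_ge0 ?(ltW iE0)//; lra.
by rewrite ler_norml; apply/andP; split; lra.
Qed.

(** Integrate [2 e |u| <= u^2 + e^2]. *)
Lemma int_norm_le_sqr u (e : R) : 0 < e -> bmeas u ->
  \int[mu]_x (u x * u x) <= e * e -> \int[mu]_x `|u x| <= e.
Proof.
move=> e0 bu ue; have bu2 := bmeasM bu bu.
have e1 : 0 < (2 * e)^-1 by rewrite invr_gt0 mulr_gt0.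
apply: (@le_trans _ _ (\int[mu]_x ((2 * e)^-1 * (u x * u x) + e / 2))).
  apply: le_int; first exact: bmeas_norm.
    by apply: bmeasD; [exact: bmeasZ|exact: bmeas_cst].
  move=> x; rewrite -(@ler_pM2l _ (2 * e)) ?mulr_gt0// mulrDr mulrA divff ?mul1r ?gt_eqF ?mulr_gt0//.
  have <- : `|u x| * `|u x| = u x * u x by rewrite -normrM ger0_norm// -expr2 sqr_ge0.
  by have := sqr_ge0 (`|u x| - e); rewrite expr2; nra.
have bue := bmeasZ (2 * e)^-1 bu2; have bc := @bmeas_cst _ T R (e / 2).
rewrite intD// int_cst intZ//.
have := ler_wpM2l (ltW e1) ue.
have -> : (2 * e)^-1 * (e * e) = e / 2 by field; rewrite gt_eqF.
by lra.
Qed.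

Lemma near_eigen_mono (r e e' : R) h : e <= e' -> near_eigen r e h -> near_eigen r e' h.
Proof. by move=> ee' [bh h0 h1 hK]; split => // x; rewrite (le_trans (hK x)). Qed.

Lemma near_eigen_mid (r e : R) h h' : near_eigen r e h -> near_eigen r e h' ->
  near_eigen r e (fun x => 1 / 2 * (h x + h' x)).
Proof.
move=> [bh h0 h1 hK] [bh' h0' h1' hK']; have bhh' := bmeasD bh bh'; split.
- exact: bmeasZ.
- by move=> x; have := h0 x; have := h0' x; move=> /andP[? ?] /andP[? ?]; apply/andP; split; lra.
- by rewrite intZ// intD// h1 h1'; lra.
move=> x; rewrite kopZ// kopD//.
have := hK x; have := hK' x; rewrite !ler_norml => /andP[? ?] /andP[? ?].
by apply/andP; split; lra.
Qed.

(** Let [h_ n] nearly minimise the integral of [h^2] among the near eigenfunctions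
with error [1 / (n + 1)]. These sets are convex and decreasing in [n], so the
parallelogram identity bounds the mean square distance of [h_ n] to [h_ m], and
[r h_ n] is uniformly close to [T (h_ n)]. *)
Lemma near_eigen_uniform_cauchy (r : R) : 0 < r ->
  (forall e, 0 < e -> exists h, near_eigen r e h) ->
  exists h_ : nat -> T -> R,
    (forall n, near_eigen r (n.+1%:R^-1) (h_ n)) /\
    (forall e, 0 < e -> exists n0, forall n, (n0 <= n)%N ->
        forall x, `|h_ n x - h_ n0 x| <= e).
Proof.
move=> r0 ex; pose ep n : R := n.+1%:R^-1.
have ep0 n : 0 < ep n by rewrite invr_gt0.
have ep_le m n : (m <= n)%N -> ep n <= ep m.
  by move=> mn; rewrite lef_pV2 ?posrE// ler_nat.
pose en (h : T -> R) := \int[mu]_x (h x * h x).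
pose S n := en @` (near_eigen r (ep n)).
have S0 n : S n !=set0 by have [h nh] := ex _ (ep0 n); exists (en h), h.
have lbS n : has_lbound (S n).
  by exists 0 => _ [h _ <-]; apply: int_ge0 => x; rewrite -expr2 sqr_ge0.
pose q n := inf (S n).
have q_le n h : near_eigen r (ep n) h -> q n <= en h.
  by move=> nh; apply: ge_inf => //; exists h.
have q_mono m n : (m <= n)%N -> q m <= q n.
  move=> mn; apply: lb_le_inf => // _ [h nh <-]; apply: q_le.
  exact: (near_eigen_mono (ep_le _ _ mn)).
have choice_h n : exists h, near_eigen r (ep n) h /\ en h < q n + ep n.
  have [|_ [h nh <-] he] := @inf_adherent _ (S n) (ep n) (ep0 n); first by split.
  by exists h.
pose h_ n := projT1 (cid (choice_h n)).
have h_n n : near_eigen r (ep n) (h_ n) by exact: (projT2 (cid (choice_h n))).1.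
have h_e n : en (h_ n) < q n + ep n by exact: (projT2 (cid (choice_h n))).2.
exists h_; split => // e e0.
have q_ub n : q n <= (2 / r) * (2 / r).
  apply: (le_trans (q_le _ _ (h_n n))); have [bh h0 _ _] := h_n n.
  apply: int_le_cst; first exact: bmeasM.
  by move=> x; have /andP[? ?] := h0 x; apply: ler_pM.
have supq : has_sup (range q).
  split; first by exists (q 0%N), 0%N.
  by exists ((2 / r) * (2 / r)) => _ [n _ <-].
pose c := r * e / 2; have c0 : 0 < c by rewrite divr_gt0// mulr_gt0.
have cc0 : 0 < c * c / 4 by rewrite divr_gt0// mulr_gt0.
have [_ [n1 _ <-] qn1] := sup_adherent cc0 supq.
have q_sup n : q n <= sup (range q) by apply: ub_le_sup; [case: supq|exists n].
have [n2 epn2] : exists n2, ep n2 < Num.min (c / 2) (c * c / 8).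
  have m0 : 0 < Num.min (c / 2) (c * c / 8) by rewrite lt_min !divr_gt0// mulr_gt0.
  exists (Num.bound (Num.min (c / 2) (c * c / 8))^-1).
  rewrite -[ltRHS]invrK ltf_pV2 ?posrE ?invr_gt0//.
  rewrite (lt_trans (archi_boundP _))// ?invr_ge0 ?(ltW m0)// ltr_nat//.
pose n0 := maxn n1 n2; exists n0 => n nn0 x.
have ep1 : ep n0 < c / 2.
  by rewrite (le_lt_trans (ep_le _ _ (leq_maxr n1 n2)))// (lt_le_trans epn2)// ge_min lexx.
have ep2 : ep n0 < c * c / 8.
  by rewrite (le_lt_trans (ep_le _ _ (leq_maxr n1 n2)))// (lt_le_trans epn2)// ge_min lexx orbT.
have q0 : q n1 <= q n0 by apply: q_mono; exact: leq_maxl.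
have epn : ep n <= ep n0 by exact: ep_le.
have nhn : near_eigen r (ep n0) (h_ n) by exact: near_eigen_mono (h_n n).
have /q_le qmid := near_eigen_mid (h_n n0) nhn.
have [b0 _ _ K0] := h_n n0; have [bn _ _ Kn] := nhn.
pose g y := h_ n y - h_ n0 y.
have bg : bmeas g by exact: bmeasB.
(* parallelogram identity, with the midpoint of [h_ n0] and [h_ n] *)
have par : \int[mu]_y (g y * g y) = 2 * en (h_ n) + 2 * en (h_ n0)
    - 4 * en (fun y => 1 / 2 * (h_ n0 y + h_ n y)).
  have b00 := bmeasM b0 b0; have bnn := bmeasM bn bn.
  have bm := bmeasZ (1 / 2) (bmeasD b0 bn); have bmm := bmeasM bm bm.
  rewrite /en -!intZ// -intD; [|exact: bmeasZ..].
  rewrite -intB; [|by apply: bmeasD; exact: bmeasZ|exact: bmeasZ].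
  by apply: int_ext => y; rewrite /g; field.
have gc : \int[mu]_y (g y * g y) <= c * c.
  have := h_e n; have := h_e n0; have := q_sup n; rewrite par; lra.
have gL1 := int_norm_le_sqr c0 bg gc.
have Kg := le_trans (norm_kop_le mu x dK bg) gL1.
move: Kg; rewrite /g kopB// => Kg.
have {}K0 := K0 x; have {}Kn := Kn x.
have re : r * e = 2 * c by rewrite /c; lra.
rewrite -(@ler_pM2l _ r)// re.
rewrite (_ : r * _ = `|r * h_ n x - r * h_ n0 x|); last first.
  by rewrite -mulrBr normrM (ger0_norm (ltW r0)).
move: Kg K0 Kn; rewrite !ler_norml.
by move=> /andP[? ?] /andP[? ?] /andP[? ?]; apply/andP; split; lra.
Qed.

Lemma eigenfunction_of_near (r : R) : 0 < r ->
  (forall e, 0 < e -> exists h, near_eigen r e h) ->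
  exists h, [/\ bmeas h, forall x, 0 <= h x, \int[mu]_x h x = 1 &
    forall x, kop K h x = r * h x].
Proof.
move=> r0 /(near_eigen_uniform_cauchy r0)[h_ [h_n hC]].
have hcv x : cvgn (h_ ^~ x).
  apply: cauchy_cvg; apply/cauchy_exP => e e0.
  have e20 : 0 < e / 2 by rewrite divr_gt0.
  have [n0 hn0] := hC _ e20; exists (h_ n0 x); exists n0 => // n /= n0n.
  rewrite /ball/= distrC (le_lt_trans (hn0 n n0n x))//; lra.
pose h x := limn (h_ ^~ x).
have close e : 0 < e -> exists n, n.+1%:R^-1 <= e /\ forall x, `|h x - h_ n x| <= e.
  move=> e0; have e30 : 0 < e / 3 by rewrite divr_gt0.
  have [n0 hn0] := hC _ e30.
  pose n := maxn n0 (Num.bound e^-1); exists n; split.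
    rewrite -[leRHS]invrK lef_pV2 ?posrE ?invr_gt0//.
    rewrite (le_trans (ltW (archi_boundP _)))// ?invr_ge0 ?(ltW e0)// ler_nat.
    by rewrite (leq_trans (leq_maxr n0 _))// leqnSn.
  move=> x; have /cvgrPdist_lt/(_ _ e30)[m _ hm] := hcv x.
  have := hm (maxn m n) (leq_maxl _ _); rewrite /= -/(h x).
  have := hn0 (maxn m n) (leq_trans (leq_maxl n0 _) (leq_maxr m n)) x.
  have := hn0 n (leq_maxl n0 _) x.
  move=> /ler_normlP[? ?] /ler_normlP[? ?] /ltr_normlP[? ?].
  by apply/ler_normlP; split; lra.
have h0 x : 0 <= h x.
  apply: limr_ge => //; apply: nearW => n.
  by have [_ /(_ x)/andP[]] := h_n n.
have hub x : h x <= 2 / r.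
  apply: limr_le => //; apply: nearW => n.
  by have [_ /(_ x)/andP[]] := h_n n.
have bh : bmeas h.
  split.
    apply: (measurable_fun_cvg (h := h_)) => [n|x _]; first by have [[]] := h_n n.
    exact: hcv.
  by exists (2 / r) => x; rewrite ger0_norm.
exists h; split => //.
  apply/eqP; rewrite -subr_eq0 -normr_le0; apply/ler_addgt0Pr => e e0.
  have [n [_ hn]] := close _ e0; have [bn _ h1 _] := h_n n.
  have bhn := bmeasB bh bn.
  rewrite add0r -h1 -intB// (le_trans (le_norm_int _ bhn))// int_le_cst//.
  exact: bmeas_norm.
move=> x; apply/eqP; rewrite -subr_eq0 -normr_le0; apply/ler_addgt0Pr => e e0.
rewrite add0r; pose e' := e / (2 + r).
have e'0 : 0 < e' by rewrite divr_gt0// addr_gt0.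
have [n [ne hn]] := close _ e'0; have [bn _ _ Kn] := h_n n.
have bhn := bmeasB bh bn.
have k1 : `|kop K h x - kop K (h_ n) x| <= e'.
  rewrite -kopB// (le_trans (norm_kop_le _ _ dK bhn))// int_le_cst//.
  exact: bmeas_norm.
have k2 := le_trans (Kn x) ne.
have k3 : `|r * (h x - h_ n x)| <= r * e'.
  by rewrite normrM (ger0_norm (ltW r0)) ler_wpM2l// ltW.
have -> : e = (2 + r) * e' by rewrite mulrC divfK// gt_eqF// addr_gt0.
move: k1 k2 k3 => /ler_normlP[? ?] /ler_normlP[? ?] /ler_normlP[? ?].
by apply/ler_normlP; split; lra.
Qed.

End PositiveEigenfunction.

(** * The spectral radius is the infimum of the growth bounds *)

Section SpectralRadius.
Context d (T : measurableType d) (R : realType) (mu : probability T R).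
Variables (K : T * T -> R) (dK : digraphon K).
Implicit Types (u v : T -> R).
Local Notation kop := (kop mu).

(** With [m = sup (v / u)] one has [l v <= T v <= m T u <= m t u], so that
[m <= m t / l]. *)
Lemma subeigenfunction_le v (l t : R) : bmeas v -> (forall x, 0 <= v x) ->
  (exists x, 0 < v x) -> (forall x, l * v x <= kop K v x) ->
  growth_bound mu K t -> l <= t.
Proof.
move=> bv v0 [x0 vx0] lv [t0 [u [bu u1 Ku]]].
have u0 x : 0 < u x by rewrite (lt_le_trans _ (u1 x)).
have [C C0 vC] := bmeas_ub bv.
pose A := range (fun x => v x / u x).
have supA : has_sup A.
  split; first by exists (v x0 / u x0), x0.
  exists C => _ [x _ <-]; rewrite ler_pdivrMr// (@le_trans _ _ C)//.
    by rewrite (le_trans (ler_norm _)).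
  by rewrite ler_peMr// ltW.
have mA x : v x / u x <= sup A by apply: ub_le_sup; [case: supA|exists x].
have m0 : 0 < sup A by rewrite (lt_le_trans _ (mA x0))// divr_gt0.
have vm x : v x <= sup A * u x by rewrite -ler_pdivrMr.
rewrite leNgt; apply/negP => tl; have l0 := lt_trans t0 tl.
have : sup A <= sup A * (t / l).
  apply: ge_sup; first by case: supA.
  move=> _ [x _ <-]; rewrite ler_pdivrMr//.
  rewrite -(@ler_pM2l _ l)// (le_trans (lv x))//.
  have le1 : kop K v x <= kop K (fun y => sup A * u y) x.
    by apply: le_kop => //; exact: bmeasZ.
  rewrite (le_trans le1)// kopZ//.
  have -> : l * (sup A * (t / l) * u x) = sup A * (t * u x).
    by field; rewrite gt_eqF.
  by rewrite ler_wpM2l// ltW.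
by rewrite ler_pMr// ler_pdivlMr// mul1r leNgt tl.
Qed.

Lemma normc_ge0 (z : R[i]) : 0 <= normc z.
Proof. by case: z => a b; rewrite /normc sqrtr_ge0. Qed.

Lemma normc_sqr (z : R[i]) : normc z ^+ 2 = complex.Re z ^+ 2 + complex.Im z ^+ 2.
Proof. by case: z => a b; rewrite /normc/= sqr_sqrtr// addr_ge0// sqr_ge0. Qed.

Lemma complexL2_integrable (f : T -> R[i]) : complexL2 mu f ->
  mu.-integrable setT (EFin \o (fun x => normc (f x))).
Proof.
move=> [mr mi fin]; apply/Lfun1_integrable; apply: Lfun_subset12.
  exact: fin_num_measure.
rewrite inE; apply/andP; split; rewrite inE//=.
rewrite (_ : (fun x => normc (f x)) =
  Num.sqrt \o (fun x => complex.Re (f x) ^+ 2 + complex.Im (f x) ^+ 2)).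
  apply: measurableT_comp; last by apply: measurable_funD; exact: measurable_funX.
  by apply: continuous_measurable_fun; exact: sqrt_continuous.
by apply/funext => x /=; rewrite -normc_sqr sqrtr_sqr ger0_norm// normc_ge0.
Qed.

Lemma abs_Re_le (z : R[i]) : `|complex.Re z| <= normc z.
Proof.
rewrite -sqrtr_sqr -[leRHS](@ger0_norm _ (normc z)) ?normc_ge0// -[leRHS]sqrtr_sqr.
by rewrite ler_wsqrtr// normc_sqr lerDl sqr_ge0.
Qed.

Lemma abs_Im_le (z : R[i]) : `|complex.Im z| <= normc z.
Proof.
rewrite -sqrtr_sqr -[leRHS](@ger0_norm _ (normc z)) ?normc_ge0// -[leRHS]sqrtr_sqr.
by rewrite ler_wsqrtr// normc_sqr lerDr sqr_ge0.
Qed.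

Lemma integrable_mul_kernel (f : T -> R) x : mu.-integrable setT (EFin \o f) ->
  mu.-integrable setT (EFin \o (fun y => f y * K (y, x))).
Proof.
move=> intf; have [mK K01] := bmeas_sectionr x (bmeas_digraphon dK).
have mf : measurable_fun setT f by apply/measurable_EFinP; exact: measurable_int intf.
apply: (le_integrable _ _ _ intf) => //.
  by apply/measurable_EFinP; exact: measurable_funM.
move=> y _ /=; rewrite lee_fin normrM ler_piMr// ger0_norm ?digraphon_le1//.
exact: digraphon_ge0.
Qed.

(** The triangle inequality for complex integrals: for [a + i b] the integral of [h],
[a^2 + b^2] is the integral of [a Re h + b Im h], and Cauchy-Schwarz in the plane
bounds the integrand by [|a + i b| |h|]. *)
Lemma normc_kernel_op_le (f : T -> R[i]) x : complexL2 mu f ->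
  normc (kernel_op mu K f x) <= \int[mu]_y (normc (f y) * K (y, x)).
Proof.
move=> f2; have [mr mi _] := f2; have intg := complexL2_integrable f2.
have intr : mu.-integrable setT (EFin \o (fun y => complex.Re (f y))).
  apply: (le_integrable _ _ _ intg) => //; first exact/measurable_EFinP.
  by move=> y _ /=; rewrite lee_fin (ger0_norm (normc_ge0 _)) abs_Re_le.
have inti : mu.-integrable setT (EFin \o (fun y => complex.Im (f y))).
  apply: (le_integrable _ _ _ intg) => //; first exact/measurable_EFinP.
  by move=> y _ /=; rewrite lee_fin (ger0_norm (normc_ge0 _)) abs_Im_le.
have intrK := integrable_mul_kernel x intr.
have intiK := integrable_mul_kernel x inti.
have intgK := integrable_mul_kernel x intg.
pose a := \int[mu]_y (complex.Re (f y) * K (y, x)).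
pose b := \int[mu]_y (complex.Im (f y) * K (y, x)).
have -> : kernel_op mu K f x = Complex a b.
  rewrite /kernel_op /cintegral; congr Complex; apply: int_ext => y;
    by case: (f y) => p q /=; ring.
set c := \int[mu]_y _; set N := normc (Complex a b).
have N0 : 0 <= N by exact: normc_ge0.
have c0 : 0 <= c.
  by apply: int_ge0 => y; rewrite mulr_ge0 ?normc_ge0 ?digraphon_ge0.
have NN : N * N <= N * c.
  have -> : N * N = \int[mu]_y (a * (complex.Re (f y) * K (y, x)) +
                                b * (complex.Im (f y) * K (y, x))).
    rewrite RintegralD//.
    - by rewrite !RintegralZl// -/a -/b -expr2 normc_sqr /= -!expr2.
    - exact: (integrableZl measurableT a intrK).
    - exact: (integrableZl measurableT b intiK).
  rewrite /c -RintegralZl//; apply: le_Rintegral => //.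
  - apply: (@integrableD _ _ _ _ _ _ (EFin \o (fun y => a * (complex.Re (f y) * K (y, x))))
     (EFin \o (fun y => b * (complex.Im (f y) * K (y, x))))) => //.
    + exact: (integrableZl measurableT a intrK).
    + exact: (integrableZl measurableT b intiK).
  - exact: (integrableZl measurableT N intgK).
  move=> y _; rewrite !mulrA -mulrDl ler_wpM2r ?digraphon_ge0//.
  rewrite (le_trans (ler_norm _))// -(@ler_pXn2r _ 2) ?nnegrE ?mulr_ge0 ?normc_ge0//.
  rewrite exprMn !normc_sqr/= real_normK ?num_real//.
  move: (complex.Re (f y)) (complex.Im (f y)) => p q.
  by rewrite -subr_ge0 (_ : _ - _ = (a * q - b * p) ^+ 2) ?sqr_ge0//; ring.
move: N0; rewrite le_eqVlt => /predU1P[<-//|N0].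
by rewrite ler_pM2l in NN.
Qed.

(** An eigenfunction [f] is only square integrable, but [|lam| |f| <= T |f|] bounds it
almost everywhere. Applying [T] to the truncation of [|f|] yields a bounded
function for which the inequality of [subeigenfunction_le] holds everywhere. *)
Lemma normc_eigenvalue_le (lam : R[i]) (t : R) : kernel_eigenvalue mu K lam ->
  growth_bound mu K t -> normc lam <= t.
Proof.
move=> [f [f2 fn0 fe]] gt; have t0 := gt.1.
set l := normc lam.
have [l0|l0] := eqVneq l 0; first by rewrite l0 ltW.
have lpos : 0 < l by rewrite lt_def l0 normc_ge0.
pose g x := normc (f x); have g0 x : 0 <= g x by exact: normc_ge0.
have intg : mu.-integrable setT (EFin \o g) by exact: complexL2_integrable.
have mg : measurable_fun setT g by apply/measurable_EFinP; exact: measurable_int intg.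
pose C := \int[mu]_y g y; have C0 : 0 <= C by exact: int_ge0.
have [N [mN N0 fN]] := fe.
have lg x : ~ N x -> l * g x <= \int[mu]_y (g y * K (y, x)).
  move=> Nx; have fx : kernel_op mu K f x = lam * f x.
    by apply: contrapT => fx; apply: Nx; apply: fN.
  by rewrite /l /g -normcM -fx; exact: normc_kernel_op_le.
have KC x : \int[mu]_y (g y * K (y, x)) <= C.
  apply: le_Rintegral => //; first exact: integrable_mul_kernel.
  by move=> y _; rewrite ler_piMr// digraphon_le1.
pose h x := Num.min (g x) (C / l).
have bh : bmeas h.
  split; first exact: measurable_minr.
  exists (C / l) => x; rewrite ger0_norm ?ge_min ?lexx ?orbT//.
  by rewrite le_min g0 divr_ge0// ltW.
have h0 x : 0 <= h x by rewrite le_min g0 divr_ge0// ltW.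
have hg x : ~ N x -> h x = g x.
  move=> Nx; apply/min_idPl; rewrite ler_pdivlMr// mulrC.
  exact: le_trans (lg x Nx) (KC x).
have KE x : \int[mu]_y (g y * K (y, x)) = kop K h x.
  have intgK := integrable_mul_kernel x intg.
  have bhK := bmeas_kop_integrand x dK bh.
  rewrite /kop /Rintegral; congr fine; apply: ae_eq_integral => //.
  - exact: measurable_int intgK.
  - by apply/measurable_EFinP; case: bhK.
  exists N; split => // y /= yN; apply: contrapT => Ny.
  by apply: yN => _; rewrite hg.
pose v x := l^-1 * kop K h x.
have bv : bmeas v by apply/bmeasZ/bmeas_kop.
have hv x : ~ N x -> h x <= v x.
  by move=> Nx; rewrite /v ler_pdivlMl// hg// -KE; exact: lg.
have v0 x : 0 <= v x by rewrite mulr_ge0 ?invr_ge0 ?(ltW lpos)// kop_ge0.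
apply: (subeigenfunction_le bv) => //.
  apply: contrapT => nv; apply: fn0; exists N; split => // x /= fx.
  apply: contrapT => Nx; apply: fx; apply: eq0_normc; apply/eqP.
  rewrite eq_le normc_ge0 andbT -/(g x) -hg// (le_trans (hv x Nx))// leNgt.
  by apply/negP => vx; apply: nv; exists x.
move=> x; rewrite /v mulrA divff// mul1r.
exact: (le_kop_null _ dK bh bv mN).
Qed.

Lemma kernel_eigenvalue_real (h : T -> R) (r : R) : bmeas h ->
  (forall x, 0 <= h x) -> \int[mu]_x h x = 1 ->
  (forall x, kop K h x = r * h x) -> kernel_eigenvalue mu K r%:C%C.
Proof.
move=> bh h0 h1 Kh; exists (fun x => (h x)%:C%C); split.
- have [mh _] := bh; split; [exact: mh|exact: measurable_cst|].
  rewrite /finite_norm unlock poweR_lty//; apply: integrable_lty => //.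
  have := bmeas_integrable mu (bmeasM bh bh).
  congr (_.-integrable _ _); apply/funext => x /=.
  rewrite expr0n/= addr0 sqrtr_sqr normr_id ger0_norm//.
  by rewrite powR_mulrn// expr2.
- move=> [N [mN N0 hN]]; move: h1; rewrite (int_null_support bh mN N0).
    by move/eqP; rewrite eq_sym oner_eq0.
  move=> x Nx; apply: contrapT => hx; apply: Nx; apply: hN => /= -[].
  exact: hx.
apply: aeW => x; rewrite /kernel_op /cintegral.
have -> : r%:C%C * (h x)%:C%C = Complex (r * h x) 0.
  by apply/eqP; rewrite eq_complex/=; apply/andP; split; apply/eqP; ring.
congr Complex.
  by rewrite -Kh; apply: int_ext => y /=; ring.
by rewrite -[RHS](int_cst mu); apply: int_ext => y /=; ring.
Qed.

Lemma spectral_radius_le (t : R) : growth_bound mu K t -> spectral_radius mu K <= t.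
Proof.
move=> gt; have t0 := gt.1; rewrite /spectral_radius; set S := (X in sup X).
have [->|/set0P S0] := eqVneq S set0; first by rewrite sup0 ltW.
by apply: ge_sup => // _ [lam el <-]; exact: normc_eigenvalue_le.
Qed.

Lemma eigenvalue_le_spectral_radius lam : kernel_eigenvalue mu K lam ->
  normc lam <= spectral_radius mu K.
Proof.
move=> el; apply: ub_le_sup; last by exists lam.
exists 1 => _ [l' el' <-]; apply: normc_eigenvalue_le => //.
exact: growth_bound1.
Qed.

Lemma spectral_radius_ge0 : 0 <= spectral_radius mu K.
Proof.
rewrite /spectral_radius; set S := (X in sup X).
have [->|/set0P[_ [lam el _]]] := eqVneq S set0; first by rewrite sup0.
exact: le_trans (normc_ge0 lam) (eigenvalue_le_spectral_radius el).
Qed.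

(** If the infimum [r] of the growth bounds were at least [t], it would be a positive
eigenvalue above the spectral radius. *)
Lemma growth_bound_gt (t : R) : spectral_radius mu K < t -> growth_bound mu K t.
Proof.
move=> rt; pose S := growth_bound mu K; pose r := inf S.
have Slb : has_lbound S by exists 0 => s [/ltW].
have S0 : S !=set0 by exists 1; exact: growth_bound1.
have above s : r < s -> S s.
  move=> rs; have [s' Ss' s's] := inf_lt S0 rs.
  exact: growth_bound_le (ltW s's) Ss'.
have [//|tr] := ltP r t; first exact: above.
have below s : S s -> r <= s by move=> Ss; exact: ge_inf.
have r0 : 0 < r by rewrite (lt_le_trans _ tr)// (le_lt_trans spectral_radius_ge0).
have [h [bh h0 h1 Kh]] := eigenfunction_of_near dK r0 (near_eigen_ex dK r0 above below).
have := eigenvalue_le_spectral_radius (kernel_eigenvalue_real bh h0 h1 Kh).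
rewrite /normc/= expr0n/= addr0 sqrtr_sqr (ger0_norm (ltW r0)) => rr.
by have := lt_le_trans (le_lt_trans rr rt) tr; rewrite ltxx.
Qed.

End SpectralRadius.

(** * Induced digraphons *)

Section InducedDigraphons.
Context d (T : measurableType d) (R : realType) (mu : probability T R).
Variables (G : T * T -> R) (dG : digraphon G).
Implicit Types (u v : T -> R) (A B C N : set T).
Local Notation kop := (kop mu).
Local Notation growth_bound := (growth_bound mu).
Local Notation rho A := (spectral_radius mu (induced_digraphon G A)).
Local Notation vol A := (fine (mu A)).
Local Notation ind A := (\1_A : T -> R).

Lemma indic01 A x : 0 <= ind A x <= 1.
Proof. by rewrite indicE ler0n lern1 leq_b1. Qed.

Lemma indic_in A x : A x -> ind A x = 1.
Proof. by move=> Ax; rewrite indicE mem_set. Qed.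

Lemma indic_notin A x : ~ A x -> ind A x = 0.
Proof. by move=> Ax; rewrite indicE memNset. Qed.

Lemma bmeas_indicM A u : measurable A -> bmeas u -> bmeas (fun y => ind A y * u y).
Proof. by move=> mA; apply: bmeasM; exact: bmeas_indic. Qed.

Lemma induced_digraphonE A y x :
  induced_digraphon G A (y, x) = ind A y * ind A x * G (y, x).
Proof.
rewrite /induced_digraphon /patch; case: ifPn => [|/negP].
  by rewrite inE => -[/= Ay Ax]; rewrite !indic_in// !mul1r.
rewrite inE => nA; have [Ay|Ay] := pselect (A y); last by rewrite indic_notin// !mul0r.
have [Ax|Ax] := pselect (A x); last by rewrite (indic_notin Ax) mulr0 mul0r.
by exfalso; apply: nA.
Qed.

Lemma kop_induced A u x : measurable A -> bmeas u ->
  kop (induced_digraphon G A) u x = ind A x * kop G (fun y => ind A y * u y) x.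
Proof.
move=> mA bu; rewrite /kop -intZ.
  by apply: int_ext => y; rewrite induced_digraphonE; ring.
exact/bmeas_kop_integrand/bmeas_indicM.
Qed.

Lemma kop_induced_in A u x : measurable A -> bmeas u -> A x ->
  kop (induced_digraphon G A) u x = kop G (fun y => ind A y * u y) x.
Proof. by move=> mA bu Ax; rewrite kop_induced// indic_in// mul1r. Qed.

Lemma kop_induced_notin A u x : measurable A -> bmeas u -> ~ A x ->
  kop (induced_digraphon G A) u x = 0.
Proof. by move=> mA bu Ax; rewrite kop_induced// indic_notin// mul0r. Qed.

Lemma growth_bound_induced A u (t : R) : measurable A -> 0 < t -> bmeas u ->
  (forall x, 1 <= u x) ->
  (forall x, A x -> kop G (fun y => ind A y * u y) x <= t * u x) ->
  growth_bound (induced_digraphon G A) t.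
Proof.
move=> mA t0 bu u1 Ku; split => //; exists u; split => // x.
have [Ax|Ax] := pselect (A x); first by rewrite kop_induced_in//; exact: Ku.
by rewrite kop_induced_notin// mulr_ge0 ?(ltW t0)// (le_trans _ (u1 x)).
Qed.

Lemma kop_indic_le A x : measurable A -> kop G (ind A) x <= vol A.
Proof.
move=> mA; rewrite -int_indic//; by apply: kop_le_int => //; exact: bmeas_indic.
Qed.

Lemma kop_le_bound u x (c : R) : bmeas u -> (forall y, 0 <= u y <= c) ->
  kop G u x <= c.
Proof.
move=> bu uc; apply: (@le_trans _ _ (\int[mu]_y u y)).
  by apply: kop_le_int => // y; have /andP[] := uc y.
by apply: int_le_cst => // y; have /andP[] := uc y.
Qed.

Lemma indicM_bound A u (c : R) y : 0 <= u y <= c -> 0 <= ind A y * u y <= c.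
Proof.
move=> /andP[u0 uc]; have /andP[i0 i1] := indic01 A y.
by rewrite mulr_ge0//= (le_trans _ uc)// ler_piMl.
Qed.

(** Extend [u] by a large constant [M] to [A' \ A]. On [A' \ A] this absorbs
everything, and seen from [A] the new part contributes at most [M] times the
measure of [A' \ A], which is at most [e]. *)
Lemma growth_bound_enlarge A (t e : R) : measurable A ->
  growth_bound (induced_digraphon G A) t -> 0 < e ->
  exists2 del, 0 < del & forall A', measurable A' -> A `<=` A' ->
    vol (A' `\` A) < del -> growth_bound (induced_digraphon G A') (t + e).
Proof.
move=> mA [t0 [u [bu u1 Ku]]] e0; have [C C0 uC] := bmeas_ub bu.
have uC' x : u x <= C by rewrite (le_trans (ler_norm _)).
pose M := 1 + (C + 1) / t.
have M1 : 1 <= M by rewrite lerDl divr_ge0 ?(ltW t0)//; lra.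
have M0 : 0 < M by lra.
have tM : C + 1 <= t * M by rewrite /M mulrDr mulrCA divff ?gt_eqF// mulr1 mulr1; lra.
have m0 : 0 < Num.min e 1 by rewrite lt_min e0 ltr01.
exists (Num.min e 1 / M); first by rewrite divr_gt0.
move=> A' mA' AA'; rewrite ltr_pdivlMr// => Dmin.
have mD : measurable (A' `\` A) by exact: measurableD.
have De : vol (A' `\` A) * M < e by rewrite (lt_le_trans Dmin)// ge_min lexx.
have D1 : vol (A' `\` A) * M < 1 by rewrite (lt_le_trans Dmin)// ge_min lexx orbT.
have biA := @bmeas_indic _ T R _ mA; have b1 := @bmeas_cst _ T R 1.
have bMD : bmeas (fun y => M * ind (A' `\` A) y) by exact/bmeasZ/bmeas_indic.
have bAu : bmeas (fun y => ind A y * u y) by exact: bmeasM.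
have bu' : bmeas (fun x => ind A x * u x + (1 - ind A x) * M).
  apply: bmeasD => //; apply: bmeasM; last exact: bmeas_cst.
  exact: bmeasB.
apply: (growth_bound_induced (u := fun x => ind A x * u x + (1 - ind A x) * M)) => //.
- exact: addr_gt0.
- move=> x; have [Ax|Ax] := pselect (A x).
    by rewrite indic_in// subrr mul0r addr0 mul1r.
  by rewrite indic_notin// mul0r add0r subr0 mul1r.
move=> x A'x.
have split_u y : ind A' y * (ind A y * u y + (1 - ind A y) * M) =
    ind A y * u y + M * ind (A' `\` A) y.
  have [Ay|Ay] := pselect (A y).
    rewrite (indic_in Ay) (indic_in (AA' _ Ay)) indic_notin; first by ring.
    by move=> [].
  rewrite (indic_notin Ay); have [A'y|A'y] := pselect (A' y).
    by rewrite !indic_in//; ring.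
  by rewrite !indic_notin//; [ring|move=> []].
have -> : kop G (fun y => ind A' y * (ind A y * u y + (1 - ind A y) * M)) x =
    kop G (fun y => ind A y * u y) x + M * kop G (ind (A' `\` A)) x.
  rewrite -kopZ//; last exact: bmeas_indic.
  by rewrite -kopD//; congr kop; apply/funext.
have kD : M * kop G (ind (A' `\` A)) x <= vol (A' `\` A) * M.
  by rewrite mulrC ler_wpM2r ?(ltW M0)// kop_indic_le.
have [Ax|Ax] := pselect (A x).
  rewrite (indic_in Ax) subrr mul0r addr0 mul1r.
  have eu : e <= e * u x by rewrite ler_peMr// ltW.
  by have := Ku x; rewrite kop_induced_in// (mulrDl t e); lra.
rewrite (indic_notin Ax) mul0r add0r subr0 mul1r.
have : kop G (fun y => ind A y * u y) x <= C.
  by apply: kop_le_bound => // y; apply: indicM_bound; rewrite uC' (le_trans _ (u1 y)).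
have : 0 <= e * M by rewrite mulr_ge0// ltW.
by rewrite (mulrDl t e); lra.
Qed.

(** The total weight of the edges from [B] to [C]. *)
Definition flow B C := \int[mu]_x (ind C x * kop G (ind B) x).

Lemma bmeas_flow B C : measurable B -> measurable C ->
  bmeas (fun x => ind C x * kop G (ind B) x).
Proof.
move=> mB mC; apply: bmeas_indicM => //; apply: bmeas_kop => //.
exact: bmeas_indic.
Qed.

Lemma indic_kop_ge0 B C x : 0 <= ind C x * kop G (ind B) x.
Proof.
by rewrite mulr_ge0// kop_ge0.
Qed.

Lemma flow_ge0 B C : 0 <= flow B C.
Proof. by apply: int_ge0 => x; exact: indic_kop_ge0. Qed.

Lemma flowE B C : measurable B -> measurable C ->
  (\int[mu \x mu]_(z in B `*` C) (G z)%:E)%E = (flow B C)%:E.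
Proof.
move=> mB mC.
have bF : bmeas (fun z : T * T => ind B z.1 * ind C z.2 * G z).
  apply: bmeasM (bmeas_digraphon dG).
  by apply: bmeasM; [exact: (bmeas_comp measurable_fst (bmeas_indic R mB))|
    exact: (bmeas_comp measurable_snd (bmeas_indic R mC))].
rewrite integral_mkcond.
transitivity (\int[mu \x mu]_z (ind B z.1 * ind C z.2 * G z)%:E)%E.
  apply: eq_integral => -[y x] _; rewrite /patch /=; case: ifPn => [|/negP].
    by rewrite inE => -[/= By Cx]; rewrite !indic_in// !mul1r.
  rewrite inE => nBC; have [By|By] := pselect (B y); last by rewrite indic_notin// !mul0r.
  have [Cx|Cx] := pselect (C x); last by rewrite (indic_notin Cx) mulr0 mul0r.
  by exfalso; apply: nBC.
rewrite int_prod//; congr EFin.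
apply: (etrans (int_swap mu mu bF)).
apply: int_ext => x; rewrite /kop -intZ.
  by apply: int_ext => y /=; ring.
exact/bmeas_kop_integrand/bmeas_indic.
Qed.

(** Rescale the function on [B] by a large factor [M], so that what enters [B] from
[C] is at most [e M]; nothing enters [C] from [B] except in a null set [N], where
the function is replaced by a large constant [L]. *)
Lemma growth_bound_block B C (t e : R) : measurable B -> measurable C ->
  B `&` C = set0 -> flow B C = 0 ->
  growth_bound (induced_digraphon G B) t ->
  growth_bound (induced_digraphon G C) t -> 0 < e ->
  growth_bound (induced_digraphon G (B `|` C)) (t + e).
Proof.
move=> mB mC BC0 fl0 [t0 [uB [buB uB1 KB]]] [_ [uC [buC uC1 KC]]] e0.
have [CB CB0 uBC] := bmeas_ub buB; have [CC CC0 uCC] := bmeas_ub buC.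
have uBC' x : uB x <= CB by rewrite (le_trans (ler_norm _)).
have uCC' x : uC x <= CC by rewrite (le_trans (ler_norm _)).
have uB0 x : 0 <= uB x by rewrite (le_trans _ (uB1 x)).
have uC0 x : 0 <= uC x by rewrite (le_trans _ (uC1 x)).
have BC x : B x -> ~ C x.
  by move=> Bx Cx; have : (B `&` C) x by []; rewrite BC0.
pose N := [set x | 0 < ind C x * kop G (ind B) x].
have mN : measurable N by apply: bmeas_gt0_set; exact: bmeas_flow.
have N0 : mu N = 0%E.
  by apply: null_of_int0 => //; [exact: bmeas_flow|exact: indic_kop_ge0].
pose M := 1 + CC / e.
have M1 : 1 <= M by rewrite lerDl divr_ge0 ?(ltW e0)// ltW.
have M0 : 0 < M by lra.
have eM : CC <= e * M by rewrite /M mulrDr mulrCA divff ?gt_eqF// !mulr1; lra.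
pose L := 1 + (M * CB + CC) / t.
have MCB : 0 <= M * CB + CC by rewrite addr_ge0 ?mulr_ge0 ?(ltW M0)// ltW.
have L1 : 1 <= L by rewrite lerDl divr_ge0 ?(ltW t0).
have tL : M * CB + CC <= t * L.
  by rewrite /L mulrDr mulrCA divff ?gt_eqF// !mulr1; lra.
have biB := @bmeas_indic _ T R _ mB; have biN := @bmeas_indic _ T R _ mN.
have biC := @bmeas_indic _ T R _ mC.
have b1 := @bmeas_cst _ T R 1; have bL := @bmeas_cst _ T R L.
pose u x := ind B x * (M * uB x) +
  (1 - ind B x) * (ind N x * L + (1 - ind N x) * uC x).
have bu : bmeas u.
  apply: bmeasD; first by apply: bmeasM => //; exact: bmeasZ.
  apply: bmeasM; first exact: bmeasB.
  by apply: bmeasD; apply: bmeasM => //; exact: bmeasB.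
have uinB x : B x -> u x = M * uB x.
  by move=> Bx; rewrite /u indic_in// subrr mul0r addr0 mul1r.
have uinN x : ~ B x -> N x -> u x = L.
  by move=> Bx Nx; rewrite /u (indic_notin Bx) (indic_in Nx); ring.
have unotin x : ~ B x -> ~ N x -> u x = uC x.
  by move=> Bx Nx; rewrite /u (indic_notin Bx) (indic_notin Nx); ring.
have u1 x : 1 <= u x.
  have [Bx|Bx] := pselect (B x).
    by rewrite uinB//; have := uB1 x; nra.
  have [Nx|Nx] := pselect (N x); first by rewrite uinN.
  by rewrite unotin.
apply: (growth_bound_induced (u := u)) => //; [exact: measurableU|exact: addr_gt0|].
move=> x BCx.
have bBu : bmeas (fun y => ind B y * uB y) by exact: bmeasM.
have bCu : bmeas (fun y => ind C y * uC y) by exact: bmeasM.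
have bMBu : bmeas (fun y => M * (ind B y * uB y)) by exact: bmeasZ.
have mBC : measurable (B `|` C) by exact: measurableU.
set a := kop G (fun y => ind B y * uB y) x.
set c := kop G (fun y => ind C y * uC y) x.
have Kac : kop G (fun y => ind (B `|` C) y * u y) x <= M * a + c.
  rewrite -kopZ// -kopD//; apply: (le_kop_null _ dG _ _ mN) => //.
  - exact: bmeas_indicM.
  - exact: bmeasD.
  move=> y Ny; have [By|By] := pselect (B y).
    rewrite uinB// (indic_in By) (indic_notin (BC _ By)) indic_in; last by left.
    by rewrite !mul1r mul0r addr0.
  rewrite unotin// (indic_notin By) mul0r mulr0 add0r.
  have [Cy|Cy] := pselect (C y); first by rewrite !indic_in//; right.
  by rewrite !indic_notin//; case.
have cC : c <= CC.
  by apply: kop_le_bound => // y; apply: indicM_bound; rewrite uCC' uC0.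
have aB : a <= CB * kop G (ind B) x.
  rewrite -kopZ//; apply: le_kop => //; first exact: bmeasZ.
  by move=> y; rewrite mulrC ler_wpM2r//; have /andP[] := indic01 B y.
have kB1 : kop G (ind B) x <= 1.
  by apply: kop_le_bound => // y; exact: indic01.
have aB' : a <= CB by rewrite (le_trans aB)// ler_piMr// ltW.
apply: (le_trans Kac).
have [Bx|Bx] := pselect (B x).
  have := KB x; rewrite kop_induced_in// -/a uinB// => aK.
  have := ler_wpM2l (ltW M0) aK; have := uB1 x => uBx.
  have : e * M <= e * M * uB x by rewrite ler_peMr// mulr_ge0// ltW.
  by move: eM cC; nra.
have Cx : C x by case: BCx.
have [Nx|Nx] := pselect (N x).
  rewrite uinN//; have := ler_wpM2l (ltW M0) aB'.
  have : 0 <= e * L by rewrite mulr_ge0 ?(ltW e0)//; lra.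
  by rewrite (mulrDl t e); lra.
have kB0 : kop G (ind B) x <= 0.
  by rewrite leNgt; apply/negP => k0; apply: Nx; rewrite /N/= indic_in// mul1r.
have a0 : M * a <= 0.
  have CBk := mulr_ge0_le0 (ltW CB0) kB0.
  exact: mulr_ge0_le0 (ltW M0) (le_trans aB CBk).
rewrite unotin//; have := KC x; rewrite kop_induced_in// -/c.
have : 0 <= e * uC x by rewrite mulr_ge0// ltW.
by rewrite (mulrDl t e); lra.
Qed.

Lemma rho_block B C : measurable B -> measurable C ->
  B `&` C = set0 -> flow B C = 0 ->
  rho (B `|` C) <= Num.max (rho B) (rho C).
Proof.
move=> mB mC BC0 fl0; apply/ler_addgt0Pr => e e0.
have e20 : 0 < e / 2 by rewrite divr_gt0.
set m := Num.max _ _.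
have -> : m + e = m + e / 2 + e / 2 by lra.
apply: spectral_radius_le; first exact/digraphon_induced/measurableU.
apply: growth_bound_block => //; apply: growth_bound_gt => //; try exact: digraphon_induced.
  by rewrite (@le_lt_trans _ _ m) ?ltrDl// le_max lexx.
by rewrite (@le_lt_trans _ _ m) ?ltrDl// le_max lexx orbT.
Qed.

(** The constant function [1] shows that the measure of [A] is essentially a growth
bound. *)
Lemma rho_le_vol A : measurable A -> rho A <= vol A.
Proof.
move=> mA; apply/ler_addgt0Pr => e e0.
apply: spectral_radius_le; first exact/digraphon_induced.
have v0 : 0 <= vol A by rewrite fine_ge0.
have b1 := @bmeas_cst _ T R 1.
apply: (growth_bound_induced (u := fun=> 1)) => //; first exact: ltr_wpDl.
move=> x Ax; rewrite mulr1 (_ : (fun y => _) = ind A).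
  by rewrite (le_trans (kop_indic_le _ _))// lerDl ltW.
by apply/funext => y; rewrite mulr1.
Qed.

Lemma rho_ge0 A : measurable A -> 0 <= rho A.
Proof. by move=> mA; apply/spectral_radius_ge0/digraphon_induced. Qed.

Lemma spectral_radius_kernel K K' : digraphon K -> digraphon K' ->
  (forall z, K z <= K' z) -> spectral_radius mu K <= spectral_radius mu K'.
Proof.
move=> dK dK' KK'; apply/ler_addgt0Pr => e e0; apply: spectral_radius_le => //.
apply: (growth_bound_kernel dK dK' KK').
by apply: growth_bound_gt => //; rewrite ltrDl.
Qed.

Lemma rho_mono A B : measurable A -> measurable B -> A `<=` B -> rho A <= rho B.
Proof.
move=> mA mB AB; apply: spectral_radius_kernel; try exact: digraphon_induced.
move=> [y x]; rewrite !induced_digraphonE ler_wpM2r ?digraphon_ge0//.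
apply: ler_pM; try by [have /andP[] := indic01 A y | have /andP[] := indic01 A x].
  have [Ay|Ay] := pselect (A y); first by rewrite !indic_in//; exact: AB.
  by rewrite (indic_notin Ay); have /andP[] := indic01 B y.
have [Ax|Ax] := pselect (A x); first by rewrite !indic_in//; exact: AB.
by rewrite (indic_notin Ax); have /andP[] := indic01 B x.
Qed.

End InducedDigraphons.

(** * A strongly connected set that carries the spectral radius *)

Section NullSets.
Context d (T : measurableType d) (R : realType) (mu : probability T R).
Implicit Types A B : set T.
Local Notation vol A := (fine (mu A)).

Lemma volK A : measurable A -> mu A = (vol A)%:E.
Proof. by move=> mA; rewrite fineK//; exact: fin_num_measure. Qed.

Lemma volU A B : measurable A -> measurable B -> A `&` B = set0 ->
  vol (A `|` B) = vol A + vol B.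
Proof.
move=> mA mB AB; rewrite measureU// fineD//; exact: fin_num_measure.
Qed.

Lemma vol_mono A B : measurable A -> measurable B -> A `<=` B -> vol A <= vol B.
Proof.
by move=> mA mB AB; rewrite -lee_fin -!volK//; apply: le_measure; rewrite ?inE.
Qed.

Lemma vol_gt0 A : measurable A -> (0 < mu A)%E -> 0 < vol A.
Proof. by move=> mA; rewrite volK. Qed.

Lemma measure_Ngt0 A : ~ (0 < mu A)%E -> mu A = 0%E.
Proof. by move=> /negP; rewrite -leNgt measure_le0 => /eqP. Qed.

Lemma null_bigcup (F : nat -> set T) : (forall n, measurable (F n)) ->
  (forall n, mu (F n) = 0%E) -> mu (\bigcup_n F n) = 0%E.
Proof.
move=> mF F0; apply: measure_negligible; first exact: bigcup_measurable.
by apply: negligible_bigcup => n; apply/negligibleP; [exact: mF|exact: F0].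
Qed.

End NullSets.

Section StronglyConnectedCore.
Context d (T : measurableType d) (R : realType) (mu : probability T R).
Variables (G : T * T -> R) (dG : digraphon G).
Implicit Types (A B C : set T).
Local Notation rho A := (spectral_radius mu (induced_digraphon G A)).
Local Notation vol A := (fine (mu A)).
Local Notation flow := (flow mu G).

Lemma rho_bigcap (A : nat -> set T) (r : R) : (forall n, measurable (A n)) ->
  (forall n, A n.+1 `<=` A n) -> (forall n, r <= rho (A n)) ->
  r <= rho (\bigcap_n A n).
Proof.
move=> mA Adec rA; set B := \bigcap_n A n.
have mB : measurable B by exact: bigcap_measurable.
rewrite leNgt; apply/negP => Br.
pose t := (rho B + r) / 2; pose e := (r - t) / 2.
have Bt : rho B < t by rewrite /t; lra.
have e0 : 0 < e by rewrite /e /t; lra.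
have tr : t + e < r by rewrite /e /t; lra.
have gB := growth_bound_gt (digraphon_induced dG mB) Bt.
have [del del0 Hdel] := growth_bound_enlarge dG mB gB e0.
have mD n : measurable (A n `\` B) by exact: measurableD.
have [n Dn] : exists n, vol (A n `\` B) < del.
  pose F n := A n `\` B.
  have F0 : \bigcap_n F n = set0.
    apply/seteqP; split => // x Fx; have [_ nBx] := Fx 0%N I.
    by apply: nBx => n _; have [] := Fx n I.
  have : (mu \o F) @ \oo --> mu (\bigcap_n F n).
    apply: nonincreasing_cvg_mu => //.
    - by apply: (@le_lt_trans _ _ 1%E); [apply: probability_le1; exact: mD|exact: ltry].
    - by rewrite F0.
    - apply/nonincreasing_seqP => n; apply/subsetPset => x [Ax nB].
      by split => //; exact: Adec.
  rewrite F0 measure0 => /fine_cvgP[_ /cvgrPdist_lt/(_ _ del0)[n _ /(_ n (leqnn n))]].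
  rewrite /= sub0r normrN ger0_norm ?fine_ge0// => Fn.
  by exists n.
have BA : B `<=` A n by move=> x; exact.
have gA := Hdel _ (mA n) BA Dn.
have := spectral_radius_le (digraphon_induced dG (mA n)) gA.
by move=> rAn; have := le_lt_trans (rA n) (le_lt_trans rAn tr); rewrite ltxx.
Qed.

(** Choose a decreasing sequence whose [n]-th term has measure within [1 / (n + 1)] of
the infimum over the subsets [C] of its predecessor with [r <= rho C];
[rho_bigcap] applies to the intersection. *)
Lemma minimal_support A (r : R) : measurable A -> r <= rho A ->
  exists B, [/\ measurable B, B `<=` A, r <= rho B &
    forall C, measurable C -> C `<=` B -> r <= rho C -> vol B <= vol C].
Proof.
move=> mA rA; pose F B := measurable B /\ r <= rho B.
have next (nB : nat * set T) : exists B', F nB.2 ->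
    [/\ F B', B' `<=` nB.2 &
     forall C, F C -> C `<=` nB.2 -> vol B' <= vol C + nB.1.+1%:R^-1].
  case: nB => n B /=; have [FB|nFB] := pselect (F B); last by exists B.
  pose S := [set vol C | C in [set C | F C /\ C `<=` B]].
  have S0 : S !=set0 by exists (vol B), B; split.
  have lbS : has_lbound S by exists 0 => _ [C _ <-]; rewrite fine_ge0.
  have n0 : 0 < n.+1%:R^-1 :> R by rewrite invr_gt0.
  have [|_ [B' [FB' B'B] <-] B'inf] := @inf_adherent _ S _ n0; first by split.
  exists B' => _; split => // C FC CB; rewrite (le_trans (ltW B'inf))// lerD2r.
  by apply: ge_inf => //; exists C.
have [g gP] := choice next.
pose fix s n := if n is m.+1 then g (m, s m) else A.
have Fs n : F (s n).
  elim: n => [//|n IH] /=; by have [] := gP (n, s n) IH.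
have sdec n : s n.+1 `<=` s n by have [] := gP (n, s n) (Fs n).
have smin n C : F C -> C `<=` s n -> vol (s n.+1) <= vol C + n.+1%:R^-1.
  by have [_ _] := gP (n, s n) (Fs n); apply.
exists (\bigcap_n s n); split.
- by apply: bigcap_measurable => // n _; case: (Fs n).
- by move=> x /(_ 0%N I).
- exact: (rho_bigcap (fun n => (Fs n).1) sdec (fun n => (Fs n).2)).
move=> C mC CB rC; apply/ler_addgt0Pr => e e0.
pose n := Num.bound e^-1.
have ne : n.+1%:R^-1 <= e.
  rewrite -[leRHS]invrK lef_pV2 ?posrE ?invr_gt0//.
  by rewrite (le_trans (ltW (archi_boundP _)))// ?invr_ge0 ?(ltW e0)// ler_nat.
have Csn : C `<=` s n by move=> x /CB /(_ n I).
apply: (@le_trans _ _ (vol (s n.+1))).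
  apply: vol_mono; first by apply: bigcap_measurable => // m _; case: (Fs m).
    by case: (Fs n.+1).
  by move=> x /(_ n.+1 I).
by rewrite (le_trans (smin n C (conj mC rC) Csn))// lerD2l.
Qed.

(** If a minimal support had a cut without edges, [rho_block] would make one of the
two sides a smaller set with the same property. *)
Lemma strongly_connected_core A (r : R) : measurable A -> 0 < r -> r <= rho A ->
  exists B, [/\ strongly_connected mu G B, B `<=` A & r <= rho B].
Proof.
move=> mA r0 rA; have [B [mB BA rB Bmin]] := minimal_support mA rA.
exists B; split => //; split => //.
  by rewrite volK// lte_fin (lt_le_trans r0)// (le_trans rB)// rho_le_vol.
move=> C D mC mD CDB CD0 C0 D0; rewrite flowE// lte_fin lt_def flow_ge0// andbT.
apply/eqP => fl0.
have volB : vol B = vol C + vol D by rewrite -CDB volU.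
have := vol_gt0 mC C0; have := vol_gt0 mD D0 => D0' C0'.
have := rho_block dG mC mD CD0 fl0; rewrite CDB => rCD.
have CB : C `<=` B by rewrite -CDB; exact: subsetUl.
have DB : D `<=` B by rewrite -CDB; exact: subsetUr.
have := le_trans rB rCD; rewrite le_max => /orP[rC|rD].
  by have := Bmin _ mC CB rC; rewrite volB gerDl leNgt D0'.
by have := Bmin _ mD DB rD; rewrite volB gerDr leNgt C0'.
Qed.

End StronglyConnectedCore.

(** * Closed walks and positivity of the spectral radius *)

Section IteratedKernels.
Context d (T : measurableType d) (R : realType) (mu : probability T R).
Variables (K : T * T -> R) (dK : digraphon K).
Implicit Types (u : T -> R).
Local Notation kop := (kop mu).

(** The kernel of the power [n.+1] of the operator. *)
Fixpoint iter_kernel n : T * T -> R :=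
  if n is m.+1 then fun p => \int[mu]_z (iter_kernel m (p.1, z) * K (z, p.2)) else K.

Lemma bmeas_iter_integrand (H : T * T -> R) : bmeas H ->
  bmeas (fun q : (T * T) * T => H (q.1.1, q.2) * K (q.2, q.1.2)).
Proof.
move=> bH; apply: bmeasM.
  apply: (bmeas_comp (h := fun q : (T * T) * T => (q.1.1, q.2))) bH.
  apply: measurable_fun_pair => //.
  exact: (measurableT_comp measurable_fst measurable_fst).
apply: (bmeas_comp (h := fun q : (T * T) * T => (q.2, q.1.2))) (bmeas_digraphon dK).
apply: measurable_fun_pair => //.
exact: (measurableT_comp measurable_snd measurable_fst).
Qed.

Lemma digraphon_iter n : digraphon (iter_kernel n).
Proof.
elim: n => [//|n IH]; have bH := bmeas_iter_integrand (bmeas_digraphon IH).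
have [mI _] := bmeas_int mu bH; split => // -[y x] /=.
have bS := bmeas_sectionl (y, x) bH; apply/andP; split.
  by apply: int_ge0 => z; rewrite mulr_ge0// digraphon_ge0.
apply: int_le_cst => // z.
by rewrite mulr_ile1 ?digraphon_ge0 ?digraphon_le1.
Qed.

Lemma bmeas_iter n : bmeas (iter_kernel n).
Proof. exact/bmeas_digraphon/digraphon_iter. Qed.

Lemma kop_iterS n u x : bmeas u ->
  kop (iter_kernel n.+1) u x = kop K (kop (iter_kernel n) u) x.
Proof.
move=> bu; have bn := bmeas_iter n.
have bF : bmeas (fun p : T * T => u p.1 * iter_kernel n p * K (p.2, x)).
  apply: bmeasM; first by apply: bmeasM => //; exact: (bmeas_comp measurable_fst bu).
  exact: (bmeas_comp measurable_snd (bmeas_sectionr x (bmeas_digraphon dK))).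
transitivity (\int[mu]_y \int[mu]_z (u y * iter_kernel n (y, z) * K (z, x))).
  apply: int_ext => y /=; rewrite -intZ.
    by apply: int_ext => z; rewrite mulrA.
  by apply: bmeasM; [exact: (bmeas_sectionl y bn)|
    exact: (bmeas_sectionr x (bmeas_digraphon dK))].
apply: (etrans (int_swap mu mu bF)); apply: int_ext => z /=.
rewrite mulrC -intZ; first by apply: int_ext => y; ring.
exact: bmeas_kop_integrand (digraphon_iter n) bu.
Qed.

Lemma kop_iter_le n u (t : R) x : 0 <= t -> bmeas u ->
  (forall x, kop K u x <= t * u x) -> kop (iter_kernel n) u x <= t ^+ n.+1 * u x.
Proof.
move=> t0 bu Ku; elim: n x => [|n IH] x; first by rewrite expr1 Ku.
rewrite kop_iterS//; have dn := digraphon_iter n.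
have bt := bmeasZ (t ^+ n.+1) bu; have bk := bmeas_kop mu dn bu.
apply: (le_trans (le_kop mu x dK bk bt IH)).
by rewrite kopZ// [in leRHS]exprSr -mulrA ler_wpM2l// exprn_ge0.
Qed.

(** The trace of the power [n.+2] of the operator. *)
Definition cycle_weight n :=
  \int[mu]_y \int[mu]_x (iter_kernel n (y, x) * K (x, y)).

Lemma bmeas_cycle_integrand n :
  bmeas (fun p : T * T => iter_kernel n p * K (p.2, p.1)).
Proof.
apply: bmeasM; first exact: bmeas_iter.
by apply: bmeas_comp (bmeas_digraphon dK); exact: measurable_swap.
Qed.

(** Since [T^(n+1) u <= t u] and [T u <= t u], the kernels [K_n(y,x) u(y) / u(x)] and
[K(x,y) u(x) / u(y)] have integral at most [t] each; their sum is at least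
[2 K_n(y,x) K(x,y)] because [a + 1 / a >= 2] and both kernels are at most [1]. *)
Lemma cycle_weight_le n (t : R) : growth_bound mu K t -> t <= 1 ->
  cycle_weight n <= t.
Proof.
move=> [t0 [u [bu u1 Ku]]] t1.
have u0 x : 0 < u x by rewrite (lt_le_trans _ (u1 x)).
have bv := bmeas_inv bu u1; set v := fun x => (u x)^-1 in bv.
have bsw : bmeas (fun p : T * T => K (p.2, p.1)).
  by apply: bmeas_comp (bmeas_digraphon dK); exact: measurable_swap.
have b1 (w : T -> R) : bmeas w -> bmeas (fun p : T * T => w p.1).
  by move=> bw; exact: (bmeas_comp measurable_fst bw).
have b2 (w : T -> R) : bmeas w -> bmeas (fun p : T * T => w p.2).
  by move=> bw; exact: (bmeas_comp measurable_snd bw).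
have bF1 : bmeas (fun p : T * T => u p.1 * iter_kernel n p * v p.2).
  by apply: bmeasM; [apply: bmeasM; [exact: b1|exact: bmeas_iter]|exact: b2].
have bF2 : bmeas (fun p : T * T => u p.2 * K (p.2, p.1) * v p.1).
  by apply: bmeasM; [apply: bmeasM => //; exact: b2|exact: b1].
have bP := bmeas_cycle_integrand n.
have half m (dm : digraphon (iter_kernel m)) x : kop (iter_kernel m) u x * v x <= t.
  rewrite ler_pdivrMr// (le_trans (kop_iter_le m x (ltW t0) bu Ku))//.
  by rewrite ler_wpM2r ?(ltW (u0 x))// exprS ler_piMr ?(ltW t0)// exprn_ile1// ltW.
have bkv m : bmeas (fun x => kop (iter_kernel m) u x * v x).
  by apply: bmeasM => //; apply: bmeas_kop => //; exact: digraphon_iter.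
have I1 : \int[mu]_y \int[mu]_x (u y * iter_kernel n (y, x) * v x) <= t.
  rewrite (int_swap mu mu bF1) /=.
  rewrite (@int_ext _ _ _ mu _ (fun x => kop (iter_kernel n) u x * v x)).
    by apply: int_le_cst => // x; apply: half; exact: digraphon_iter.
  move=> x; rewrite [RHS]mulrC /kop -intZ.
    by apply: int_ext => y; ring.
  exact: bmeas_kop_integrand (digraphon_iter n) bu.
have I2 : \int[mu]_y \int[mu]_x (u x * K (x, y) * v y) <= t.
  rewrite (@int_ext _ _ _ mu _ (fun y => kop (iter_kernel 0) u y * v y)).
    by apply: int_le_cst => // y; exact: half.
  move=> y; rewrite [RHS]mulrC /kop -intZ.
    by apply: int_ext => x /=; ring.
  exact: bmeas_kop_integrand dK bu.
have : 2 * cycle_weight n <= t + t.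
  apply: le_trans (lerD I1 I2); rewrite /cycle_weight -intZ; last exact: (bmeas_int mu bP).
  rewrite -intD; [|exact: (bmeas_int mu bF1)|exact: (bmeas_int mu bF2)].
  apply: le_int.
  - exact/bmeasZ/(bmeas_int mu bP).
  - by apply: bmeasD; [exact: (bmeas_int mu bF1)|exact: (bmeas_int mu bF2)].
  move=> y; have bP1 := bmeas_sectionl y bP.
  have bF11 := bmeas_sectionl y bF1; have bF21 := bmeas_sectionl y bF2.
  rewrite /= in bP1 bF11 bF21; rewrite -intZ// -intD//.
  apply: le_int; [exact: bmeasZ|exact: bmeasD|move=> x].
  have k0 := digraphon_ge0 (y, x) (digraphon_iter n).
  have k1 := digraphon_le1 (y, x) (digraphon_iter n).
  have K0 := digraphon_ge0 (x, y) dK; have K1 := digraphon_le1 (x, y) dK.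
  move: (iter_kernel n (y, x)) (K (x, y)) k0 k1 K0 K1 => k l k0 k1 l0 l1.
  pose a := u y * v x; have a0 : 0 < a by rewrite mulr_gt0// invr_gt0.
  have av : u x * v y = a^-1 by rewrite /a /v invfM invrK mulrC.
  rewrite mulrAC -/a [u x * l * _]mulrAC av.
  have am : 2 <= a + a^-1.
    rewrite -(ler_pM2l a0) [leRHS]mulrDr divff ?gt_eqF//.
    by have := sqr_ge0 (a - 1); rewrite expr2; nra.
  have ia0 : 0 < a^-1 by rewrite invr_gt0.
  have h1 : a * (k * l) <= a * k by rewrite ler_wpM2l ?(ltW a0)// ler_piMr.
  have h2 : a^-1 * (k * l) <= a^-1 * l by rewrite ler_wpM2l ?(ltW ia0)// ler_piMl.
  have h3 : 2 * (k * l) <= (a + a^-1) * (k * l) by rewrite ler_wpM2r// mulr_ge0.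
  by rewrite (le_trans h3)// mulrDl lerD.
by lra.
Qed.

Lemma spectral_radius_gt0 n : 0 < cycle_weight n -> 0 < spectral_radius mu K.
Proof.
move=> c0; rewrite lt_def spectral_radius_ge0// andbT; apply/eqP => r0.
pose t := Num.min 1 (cycle_weight n / 2).
have t0 : spectral_radius mu K < t by rewrite r0 lt_min ltr01 divr_gt0.
have := cycle_weight_le n (growth_bound_gt dK t0).
rewrite ge_min lexx => /(_ isT) ct.
have : t <= cycle_weight n / 2 by rewrite ge_min lexx orbT.
by lra.
Qed.

End IteratedKernels.

Section StronglyConnectedPositive.
Context d (T : measurableType d) (R : realType) (mu : probability T R).
Variables (G : T * T -> R) (dG : digraphon G).
Variables (X : set T) (scX : strongly_connected mu G X).
Implicit Types (A B C : set T).
Local Notation flow := (flow mu G).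
Local Notation ind A := (\1_A : T -> R).
Local Notation K := (induced_digraphon G X).
Local Notation kn := (iter_kernel mu K).

Let mX : measurable X. Proof. by case: scX. Qed.
Let dK : digraphon K. Proof. exact: digraphon_induced. Qed.

Lemma strongly_connected_cut B : measurable B -> B `<=` X ->
  flow B (X `\` B) = 0 -> mu B = 0%E \/ mu (X `\` B) = 0%E.
Proof.
move=> mB BX fl0; have [_ _ sc] := scX.
have mXB : measurable (X `\` B) by exact: measurableD.
have [B0|B0] := pselect (0 < mu B)%E; last by left; exact: measure_Ngt0.
have [C0|C0] := pselect (0 < mu (X `\` B))%E; last by right; exact: measure_Ngt0.
have := sc B (X `\` B) mB mXB; rewrite flowE// fl0 ltxx => sc'.
exfalso; suff : false by []; apply: sc' => //.
  by apply: setDUK.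
by rewrite setDIK.
Qed.

Lemma induced_outside y x : ~ (X y /\ X x) -> K (y, x) = 0.
Proof.
move=> nX; rewrite induced_digraphonE; have [Xy|Xy] := pselect (X y).
  have [Xx|Xx] := pselect (X x); first by exfalso; apply: nX.
  by rewrite (indic_notin R Xx) mulr0 mul0r.
by rewrite (indic_notin R Xy) !mul0r.
Qed.

Lemma induced_inside y x : X y -> X x -> K (y, x) = G (y, x).
Proof. by move=> Xy Xx; rewrite induced_digraphonE !indic_in// !mul1r. Qed.

Lemma iter_outside n y x : ~ X x -> kn n (y, x) = 0.
Proof.
move=> Xx; case: n => [|n] /=; first by apply: induced_outside => -[].
rewrite -[RHS](int_cst mu); apply: int_ext => z.
by rewrite (induced_outside (y := z) (x := x)) ?mulr0// => -[].
Qed.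

Definition reach y := \bigcup_n [set x | 0 < kn n (y, x)].

Lemma bmeas_kn_row n y : bmeas (fun x => kn n (y, x)).
Proof. exact/bmeas_sectionl/bmeas_iter. Qed.

Lemma measurable_reach y : measurable (reach y).
Proof. by apply: bigcup_measurable => n _; apply: bmeas_gt0_set; exact: bmeas_kn_row. Qed.

Lemma reach_sub y : reach y `<=` X.
Proof.
move=> x [n _ /= k0]; apply: contrapT => Xx.
by rewrite iter_outside// ltxx in k0.
Qed.

Lemma reach_not y x : ~ reach y x -> forall n, kn n (y, x) = 0.
Proof.
move=> nr n; apply/eqP; rewrite eq_le digraphon_ge0 ?andbT; last exact: digraphon_iter.
by rewrite leNgt; apply/negP => k0; apply: nr; exists n.
Qed.

(** If [x] is not reached from [y], then for each [n] the kernel [K_n(y,z) K(z,x)] has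
integral zero over [z], so almost no reached [z] has an edge to [x]. *)
Lemma flow_reach y : flow (reach y) (X `\` reach y) = 0.
Proof.
have mr := measurable_reach y.
rewrite /flow -[RHS](int_cst mu); apply: int_ext => x.
have [Dx|Dx] := pselect ((X `\` reach y) x); last by rewrite indic_notin ?mul0r.
rewrite indic_in// mul1r; have [Xx nrx] := Dx.
pose N := \bigcup_n [set z | 0 < kn n (y, z) * K (z, x)].
have bN n : bmeas (fun z => kn n (y, z) * K (z, x)).
  by apply: bmeasM; [exact: bmeas_kn_row|exact/bmeas_sectionr/bmeas_digraphon].
have mN n : measurable [set z | 0 < kn n (y, z) * K (z, x)].
  exact: bmeas_gt0_set.
have N0 : mu N = 0%E.
  apply: null_bigcup => // n; apply: null_of_int0 => //.
    by move=> z; rewrite mulr_ge0 ?digraphon_ge0//; exact: digraphon_iter.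
  exact: (reach_not nrx n.+1).
apply: (@int_null_support _ _ _ _ _ N) => //.
- by apply: bmeas_kop_integrand => //; exact: bmeas_indic.
- exact: bigcup_measurable.
move=> z nNz; have [rz|rz] := pselect (reach y z); last by rewrite indic_notin ?mul0r.
have Xz := reach_sub rz; rewrite -induced_inside//.
have [n _ /= k0] := rz; have [->|K0] := eqVneq (K (z, x)) 0; first by rewrite mulr0.
exfalso; apply: nNz; exists n => //=; rewrite mulr_gt0// lt_def K0.
exact: digraphon_ge0.
Qed.

Lemma reach_full y : mu (reach y) = 0%E \/ mu (X `\` reach y) = 0%E.
Proof.
exact: (strongly_connected_cut (measurable_reach y) (@reach_sub y) (flow_reach y)).
Qed.

Hypothesis atomless_mu : atomless mu.

Lemma atomless_split A : measurable A -> A `<=` X -> (0 < mu A)%E ->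
  exists B, [/\ measurable B, B `<=` A, (0 < mu B)%E & (0 < mu (X `\` B))%E].
Proof.
move=> mA AX A0; have [B [mB BA B0 BltA]] := atomless_mu mA A0.
exists B; split => //; have mXB : measurable (X `\` B) by exact: measurableD.
rewrite lt_def measure_ge0 andbT; apply/eqP => XB0.
have AB0 : mu (A `\` B) = 0%E.
  apply: (subset_measure0 (B := X `\` B)) => //; first exact: measurableD.
  exact: setSD.
have : mu (B `|` (A `\` B)) = mu B by apply: measureU0 => //; exact: measurableD.
by rewrite setDUK// => AB; rewrite AB ltxx in BltA.
Qed.

(** In an atomless space a set of positive measure cannot have the property that all
its subsets have no edges to the rest of [X]. *)
Let no_split A : measurable A -> A `<=` X -> (0 < mu A)%E ->
  (forall B, measurable B -> B `<=` A -> flow B (X `\` B) = 0) -> False.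
Proof.
move=> mA AX A0 fl0; have [B [mB BA B0 XB0]] := atomless_split mA AX A0.
have BX : B `<=` X by exact: subset_trans AX.
by have [B0'|XB0'] := strongly_connected_cut mB BX (fl0 B mB BA);
  [rewrite B0' ltxx in B0|rewrite XB0' ltxx in XB0].
Qed.

Lemma flow_le_out B : measurable B -> B `<=` X ->
  flow B (X `\` B) <= \int[mu]_y (ind B y * \int[mu]_x K (y, x)).
Proof.
move=> mB BX; have bB := @bmeas_indic _ T R _ mB.
have bF : bmeas (fun p : T * T => ind B p.1 * K p).
  by apply: bmeasM (bmeas_digraphon dK); exact: (bmeas_comp measurable_fst bB).
rewrite [leRHS](_ : _ = \int[mu]_x \int[mu]_y (ind B y * K (y, x))); last first.
  apply: etrans (int_swap mu mu bF); apply: int_ext => y /=.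
  by rewrite intZ//; exact: (bmeas_sectionl y (bmeas_digraphon dK)).
have bk := bmeas_kop mu dK bB.
apply: le_int => //; first by apply: bmeas_flow => //; exact: measurableD.
move=> x; have [[Xx nBx]|Dx] := pselect ((X `\` B) x); last first.
  by rewrite indic_notin// mul0r kop_ge0.
rewrite indic_in// mul1r; apply: le_int; [exact: bmeas_kop_integrand..|].
move=> y; have [By|By] := pselect (B y); last by rewrite indic_notin ?mul0r.
by rewrite induced_inside//; exact: BX.
Qed.

(** Suppose all cycle weights vanish. Almost every [y] has an out-edge, since the set
[Z] of exceptions could be split; such a [y] reaches almost all of [X] by
[reach_full]; so the vanishing of the cycle weights leaves [y] without in-edges.
Hence there are almost no edges in [X], and [X] itself could be split. *)
Lemma cycle_weight_gt0 : exists n, 0 < cycle_weight mu K n.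
Proof.
have [_ X0 _] := scX; apply: contrapT => nc.
have bP n := bmeas_cycle_integrand mu dK n.
have P0 n y x : 0 <= kn n (y, x) * K (x, y).
  by rewrite mulr_ge0 ?digraphon_ge0//; exact: digraphon_iter.
have c0 n : cycle_weight mu K n = 0.
  apply/eqP; rewrite eq_le; apply/andP; split.
    by rewrite leNgt; apply/negP => cn; apply: nc; exists n.
  by apply: int_ge0 => y; apply: int_ge0 => x.
pose M := \bigcup_n [set y | 0 < \int[mu]_x (kn n (y, x) * K (x, y))].
have mM n : measurable [set y | 0 < \int[mu]_x (kn n (y, x) * K (x, y))].
  exact/bmeas_gt0_set/(bmeas_int mu (bP n)).
have M0 : mu M = 0%E.
  apply: null_bigcup => // n; apply: null_of_int0 (c0 n).
    exact: (bmeas_int mu (bP n)).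
  by move=> y; exact: int_ge0.
pose out y := \int[mu]_x K (y, x).
have bout : bmeas out by exact/bmeas_int/bmeas_digraphon.
pose Z := X `\` [set y | 0 < out y].
have mZ : measurable Z by apply: measurableD => //; exact: bmeas_gt0_set.
have out0 y : 0 <= out y by apply: int_ge0 => x; exact: digraphon_ge0.
have Z0 : mu Z = 0%E.
  apply: measure_Ngt0 => Zpos; apply: (no_split mZ _ Zpos); first exact: subDsetl.
  move=> B mB BZ; apply/eqP; rewrite eq_le flow_ge0// andbT.
  apply: (le_trans (flow_le_out mB _)); first by move=> y /BZ[].
  rewrite (_ : \int[mu]_y _ = 0)// -[RHS](int_cst mu); apply: int_ext => y.
  have [By|By] := pselect (B y); last by rewrite indic_notin ?mul0r.
  have [_ /= nout] := BZ _ By; rewrite -/(out y) (_ : out y = 0) ?mulr0//.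
  by apply/eqP; rewrite eq_le out0 andbT leNgt; apply/negP.
have in0 y : X y -> ~ Z y -> ~ M y -> \int[mu]_x K (x, y) = 0.
  move=> Xy nZ nM; have mr := measurable_reach y.
  have outy : 0 < out y.
    by apply: contrapT => nout; apply: nZ.
  have XR0 : mu (X `\` reach y) = 0%E.
    have [r0|//] := reach_full y; exfalso.
    move: outy; rewrite /out (int_null_support _ mr r0) ?ltxx//.
      exact: (bmeas_sectionl y (bmeas_digraphon dK)).
    by move=> x /reach_not/(_ 0%N).
  pose N := \bigcup_n [set x | 0 < kn n (y, x) * K (x, y)].
  have bPy n : bmeas (fun x => kn n (y, x) * K (x, y)).
    exact: (bmeas_sectionl y (bP n)).
  have mN n : measurable [set x | 0 < kn n (y, x) * K (x, y)].
    exact: bmeas_gt0_set.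
  have N0 : mu N = 0%E.
    apply: null_bigcup => // n; apply: null_of_int0 => //.
    apply/eqP; rewrite eq_le int_ge0 ?andbT// leNgt; apply/negP => Py.
    by apply: nM; exists n.
  have mNN : measurable N by exact: bigcup_measurable.
  have mXR : measurable (X `\` reach y) by exact: measurableD.
  have NXR0 : mu (N `|` (X `\` reach y)) = 0%E by exact: null_set_setU.
  have mNXR : measurable (N `|` (X `\` reach y)) by exact: measurableU.
  apply: (int_null_support _ mNXR NXR0).
    exact: (bmeas_sectionr y (bmeas_digraphon dK)).
  move=> x nx; have [Xx|Xx] := pselect (X x); last by apply: induced_outside => -[].
  have [[n _ /= kpos]|rx] := pselect (reach y x); last by exfalso; apply: nx; right.
  apply/eqP; rewrite eq_le digraphon_ge0// andbT leNgt; apply/negP => Kpos.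
  by apply: nx; left; exists n => //=; rewrite mulr_gt0.
apply: (no_split mX _ X0) => // B mB BX.
apply/eqP; rewrite eq_le flow_ge0// andbT.
apply: (le_trans (flow_le_out mB BX)).
have bB := @bmeas_indic _ T R _ mB.
apply: (@le_trans _ _ (\int[mu]_y out y)).
  apply: le_int => //; first exact: bmeasM.
  by move=> y; rewrite -/(out y) ler_piMl//; have /andP[] := indic01 R B y.
have bK := bmeas_digraphon dK.
rewrite /out (int_swap mu mu bK).
have mZM : measurable (Z `|` M) by apply: measurableU => //; exact: bigcup_measurable.
have ZM0 : mu (Z `|` M) = 0%E.
  by apply: null_set_setU => //; exact: bigcup_measurable.
rewrite (int_null_support _ mZM ZM0)//.
  apply: (@bmeas_int _ _ _ _ _ mu (fun p => K (p.2, p.1))).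
  by apply: bmeas_comp bK; exact: measurable_swap.
move=> y nZM; have [Xy|Xy] := pselect (X y).
  by apply: in0 => // h; apply: nZM; [left|right].
by rewrite -[RHS](int_cst mu); apply: int_ext => x; apply: induced_outside => -[].
Qed.

Lemma rho_strongly_connected_gt0 : 0 < spectral_radius mu K.
Proof. by have [n] := cycle_weight_gt0; exact: spectral_radius_gt0. Qed.

End StronglyConnectedPositive.

(** * The decomposition into strong components *)

Section Decomposition.
Context d (T : measurableType d) (R : realType) (mu : probability T R).
Variables (G : T * T -> R) (dG : digraphon G).
Local Notation rho A := (spectral_radius mu (induced_digraphon G A)).

(** The null part of [B] outside [A] is split off by [rho_block]. *)
Lemma rho_le_null_diff (A B : set T) : measurable A -> measurable B ->
  mu (B `\` A) = 0%E -> rho B <= rho A.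
Proof.
move=> mA mB D0; have mD : measurable (B `\` A) by exact: measurableD.
have mI : measurable (B `&` A) by exact: measurableI.
have ID0 : (B `&` A) `&` (B `\` A) = set0.
  by apply/seteqP; split => // x [[_ Ax] [_ nAx]].
have fl0 : flow mu G (B `&` A) (B `\` A) = 0.
  apply: (int_null_support _ mD D0); first exact: bmeas_flow.
  by move=> x Dx; rewrite indic_notin ?mul0r.
have := rho_block dG mI mD ID0 fl0; rewrite setUIDK => /le_trans; apply.
rewrite ge_max; apply/andP; split; first exact: rho_mono (@subIsetr _ _ _).
by rewrite (le_trans (rho_le_vol mu dG mD))// D0 rho_ge0.
Qed.

Lemma induced_setT : induced_digraphon G setT = G.
Proof.
by apply/funext => -[y x]; rewrite induced_digraphonE !indic_in// !mul1r.
Qed.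

Lemma null_countable_cover (J : Type) (I : set J) (F : J -> set T) :
  countable I -> (forall i, I i -> measurable (F i)) ->
  (forall i, I i -> mu (F i) = 0%E) -> mu.-negligible (\bigcup_(i in I) F i).
Proof.
move=> /countable_injP[f finj] mF F0.
apply: (@negligibleS _ _ _ _ (\bigcup_n \bigcup_(i in I `&` f @^-1` [set n]) F i)).
  by move=> x [i Ii Fx]; exists (f i) => //; exists i.
apply: negligible_bigcup => n.
have [[i [Ii fi]]|nI] := pselect (exists i, I i /\ f i = n).
  apply: (@negligibleS _ _ _ _ (F i)).
    move=> x [j [Ij fj] Fx]; rewrite (finj i j) ?inE//.
    by rewrite fi fj.
  by apply/negligibleP; [exact: mF|exact: F0].
rewrite (_ : \bigcup_(_ in _) _ = set0); first exact: negligible_set0.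
by apply/seteqP; split => // x [j [Ij fj] _]; apply: nI; exists j.
Qed.

(** A strongly connected set [B] carrying the spectral radius cannot lie in [X0] up to
a null set, because [X0] has spectral radius zero by the same construction
applied inside [X0]. So it meets some component [X i] in positive measure, and by
maximality of the component lies in [X i] up to a null set. *)
Lemma component_carries_spectral_radius (J : Type) (I : set J) (X0 : set T)
    (X : J -> set T) : strong_decomposition mu G I X0 X ->
  0 < spectral_radius mu G -> exists2 i, I i & spectral_radius mu G <= rho (X i).
Proof.
move=> [[cI mX0 mX] [coverX _ _] fragX0 compX] r0.
have rX0 : rho X0 <= 0.
  have [X00|fX0] := fragX0.
    by rewrite (le_trans (rho_le_vol mu dG mX0))// X00.
  rewrite leNgt; apply/negP => rpos.
  have [B [scB BX0 _]] := strongly_connected_core dG mX0 rpos (lexx _).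
  by have [mB B0 _] := scB; exact: (fX0 B mB BX0 B0).
have rT : spectral_radius mu G <= rho setT by rewrite induced_setT.
have [B [scB _ rB]] := strongly_connected_core dG measurableT r0 rT.
have [mB _ _] := scB.
have [[i [Ii BXi]]|nI] := pselect (exists i, I i /\ (0 < mu (B `&` X i))%E).
  exists i; first exact: Ii.
  apply: (le_trans rB); apply: rho_le_null_diff; [exact: mX|exact: mB|].
  apply: measure_Ngt0 => BD; have [_ /(_ B mB)] := compX i Ii.
  by rewrite setIC => /(_ BXi BD); apply.
exfalso; suff : rho B <= rho X0.
  by move=> /(le_trans rB)/(lt_le_trans r0)/lt_le_trans/(_ rX0); rewrite ltxx.
apply: rho_le_null_diff => //; have mD : measurable (B `\` X0) by exact: measurableD.
apply: measure_negligible => //.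
apply: negligibleS (null_countable_cover (F := fun i => B `&` X i) cI _ _).
- move=> x [Bx nX0x]; have : (X0 `|` \bigcup_(i in I) X i) x by rewrite coverX.
  by case=> // -[i Ii Xix]; exists i.
- by move=> i Ii; apply: measurableI => //; exact: mX.
by move=> i Ii; apply: measure_Ngt0 => BXi; apply: nI; exists i.
Qed.

End Decomposition.

Theorem proposition5p1 (d : measure_display) (T : measurableType d)
    (R : realType) (mu : probability T R) (G : T * T -> R)
    (J : Type) (I : set J) (X0 : set T) (X : J -> set T)
    (atomless_mu : atomless mu) (digraphon_G : digraphon G)
    (decomposition_G : strong_decomposition mu G I X0 X) :
  (spectral_radius mu G =
     sup [set spectral_radius mu (induced_digraphon G (X i)) | i in I] /\
   (I !=set0 ->
     exists2 i, I i & forall j, I j ->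
       spectral_radius mu (induced_digraphon G (X j)) <=
       spectral_radius mu (induced_digraphon G (X i)))) /\
  (spectral_radius mu G = 0 <-> I = set0).
Proof.
have [[_ _ mX] _ _ compX] := decomposition_G.
have rho_le i : I i ->
    spectral_radius mu (induced_digraphon G (X i)) <= spectral_radius mu G.
  move=> Ii; rewrite -[in leRHS](induced_setT G).
  by apply: rho_mono => //; exact: mX.
have rho_gt0 i : I i -> 0 < spectral_radius mu (induced_digraphon G (X i)).
  by move=> Ii; apply: rho_strongly_connected_gt0 => //; case: (compX i Ii).
have carrier := component_carries_spectral_radius digraphon_G decomposition_G.
have [I0|/set0P[i0 Ii0]] := eqVneq I set0.
  have r0 : spectral_radius mu G = 0.
    apply/eqP; rewrite eq_le spectral_radius_ge0// andbT leNgt.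
    by apply/negP => rpos; have [j Ij _] := carrier rpos; rewrite I0 in Ij.
  by split; [split; [rewrite I0 image_set0 sup0|rewrite I0 => -[]]|].
have rpos : 0 < spectral_radius mu G.
  exact: lt_le_trans (rho_gt0 _ Ii0) (rho_le _ Ii0).
have [i Ii ri] := carrier rpos.
split; [split|].
- apply/eqP; rewrite eq_le; apply/andP; split.
    rewrite (le_trans ri)//; apply: ub_le_sup; last by exists i.
    by exists (spectral_radius mu G) => _ [j Ij <-]; exact: rho_le.
  apply: ge_sup; last by move=> _ [j Ij <-]; exact: rho_le.
  by exists (spectral_radius mu (induced_digraphon G (X i0))), i0.
- move=> _; exists i; first exact: Ii.
  by move=> j Ij; exact: le_trans (rho_le j Ij) ri.
split => [r0|I0]; first by rewrite r0 ltxx in rpos.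
by rewrite I0 in Ii0.
Qed.
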